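(* Let $N$ be a matroid on a non-empty finite set $E$, let $T$ be a skew tract, let $[\cdot]\colon A_N\to T$ be a map, and let $\mathcal{C}\subseteq T^E$. The following are equivalent. (1) $\mathcal{M}=(E,\mathcal{C})$ is a strong left (resp. right) $T$-matroid such that $\underline{\mathcal{M}}=N$ and $[\cdot]=[\cdot]_{\mathcal{C}}$. (2) $[\cdot]$ are strong left (resp. right) quasi-Plücker coordinates for $N$ and $\mathcal{C}=\mathcal{C}_{[\cdot]}$.
   Context: **Skew tracts.** A skew tract $T$ is a group $G$ (written multiplicatively, identity $1$) together with a subset $N_G$ of the group semiring $\mathbb{N}[G]$ such that: (1) $0\in N_G$; (2) $1\notin N_G$; (3) there is a unique $\epsilon\in G$ with $1+\epsilon\in N_G$; (4) $N_G$ is closed under the left and right actions of $G$ on $\mathbb{N}[G]$. Write $T=G\cup\{0\}$, $T^\times=G$, where $0$ is identified with the zero of $\mathbb{N}[G]$ and is absorbing for multiplication; $-x:=\epsilon x$ (one has $\epsilon x=x\epsilon$ and $\epsilon^2=1$). $T^E$ is the set of functions $E\to T$, with coordinatewise left and right multiplication by $T$. The support of $X\in T^E$ is $\underline{X}=\{e\in E: X(e)\neq 0\}$; for $S\subseteq T^E$, $\underline{S}$ is the set of supports of elements of $S$. **Modular families.** For a collection $C$ of pairwise incomparable non-empty subsets of $E$, $U(C)=\{\bigcup S: S\subseteq C\}$ is a lattice under inclusion (join is union, minimal element $\emptyset$). A family of members of $C$ is modular if the height of its union in $U(C)$ equals the size of the family. A family of elements of $\mathcal{C}\subseteq T^E$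 is modular if the family of supports is modular in $\underline{\mathcal{C}}$. **Strong $T$-matroids.** $\mathcal{C}\subseteq T^E$ is the $T$-circuit set of a strong left $T$-matroid $\mathcal{M}=(E,\mathcal{C})$ on $E$ if: (C1) $0\notin\mathcal{C}$; (C2) $X\in\mathcal{C}$, $\alpha\in T^\times$ imply $\alpha X\in\mathcal{C}$; (C3) if $X,Y\in\mathcal{C}$ and $\underline X\subseteq\underline Y$ then $Y=\alpha X$ for some $\alpha\in T^\times$; (C4)$'$ whenever $X_1,\dots,X_k,X\in\mathcal{C}$ together form a modular family of size $k+1$ with $\underline X\not\subseteq\bigcup_{i}\underline{X_i}$, and $e_i\in(\underline X\cap\underline{X_i})\setminus\bigcup_{j\ne i}\underline{X_j}$ satisfy $X(e_i)=-X_i(e_i)\neq0$ for $1\le i\le k$, there is $Z\in\mathcal{C}$ with $Z(e_i)=0$ for $1\le i\le k$ and $X(f)+X_1(f)+\dots+X_k(f)-Z(f)\in N_G$ for every $f\in E$. Strong right $T$-matroids are defined by replacing $\alpha X$ with $X\alpha$ in (C2), (C3). The underlying matroid $\underline{\mathcal{M}}$ is the matroid on $E$ whose circuits are the supports of the elements of $\mathcal{C}$. **Adjacent bases.** Let $N$ have rank $r$ and set of bases $\mathcal{B}$. $A_N$ is the set of ordered pairs $(B,B')$ of bases with $|B\setminus B'|=1$. $Fa_1\dots a_n$ denotes $F\cup\{a_1,\dots,a_n\}$; in (P1)–(P3) and in the last paragraph below the $a_i$ are distinct elements of $E\setminus F$. **Strong left quasi-Plücker coordinates** for $N$: a map $[\cdot]\colon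 A_N\to T$ such that (P1) $[Fa,Fb][Fb,Fa]=1$ if $|F|=r-1$, $Fa,Fb\in\mathcal{B}$; (P2) $[Fac,Fbc][Fab,Fac][Fbc,Fab]=-1$ if $|F|=r-2$, $Fab,Fac,Fbc\in\mathcal{B}$; (P3) $[Fa,Fb][Fb,Fc][Fc,Fa]=1$ if $|F|=r-1$, $Fa,Fb,Fc\in\mathcal{B}$; and, for all $I,J\subseteq E$ with $|I|=r+1$, $|J|=r-1$, $|I\setminus J|\ge3$, putting $I_1=\{x\in I: I\setminus x\in\mathcal{B}\text{ and }Jx\in\mathcal{B}\}$: (P4)$'$ if $I_1=\{a,b\}$ has size $2$, then $[I\setminus a,I\setminus b]=[Jb,Ja]$; (P5)$'$ if $|I_1|\ge3$, then for any $z\in I_1$, $-1+\sum_{x\in I_1\setminus z}[I\setminus x,I\setminus z]\cdot[Jx,Jz]\in N_G$. Strong right quasi-Plücker coordinates are defined by the same axioms with the order of all products reversed. **$[\cdot]_{\mathcal C}$ and $\mathcal C_{[\cdot]}$ (left version).** If $\mathcal{C}$ satisfies (C1)–(C3) and $\underline{\mathcal{C}}$ is the set of circuits of $N$, then $[Fa,Fb]_{\mathcal{C}}:=-X(a)^{-1}X(b)$ for any $X\in\mathcal{C}$ with $a,b\in\underline X\subseteq Fab$ (well defined). For a map $[\cdot]\colon A_N\to T$, $\mathcal{C}_{[\cdot]}:=\{X\in T^E: \underline X$ is a circuit of $N$ and $X(a)^{-1}X(b)=-[Fa,Fb]$ whenever $a,b\in\underline X\subseteq Fab$ with $(Fa,Fb)\in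 A_N\}$. In the right version the order of multiplication is reversed, i.e. $X(a)^{-1}X(b)$ is replaced by $X(b)X(a)^{-1}$. *)

(* Defs.v *)
From HB Require Import structures.
From mathcomp Require Import boolp classical_sets.
From mathcomp Require Import all_boot all_algebra finmap multiset.

Set Implicit Arguments.
Unset Strict Implicit.
Unset Printing Implicit Defensive.

Import GRing.Theory.

Local Open Scope ring_scope.

(* An element of the group semiring N[G] is a finitely supported function     *)
(* G -> N, i.e. a finite multiset over G.  Tracts only use the addition of    *)
(* N[G] and the two translation actions of G, not its convolution product.    *)
Definition group_semiring (G : groupType) : Type := {mset G}%mset.

HB.instance Definition _ (G : groupType) := Choice.on (group_semiring G).
HB.instance Definition _ (G : groupType) :=
  Algebra.isNmodule.Build (group_semiring G) (@msetDA G) (@msetDC G) (@mset0D G).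

Section GroupSemiring.
Variable G : groupType.
Implicit Types (g : G) (m : group_semiring G).

Definition gs_gen g : group_semiring G := [mset g]%mset.
Definition gs_lact g m : group_semiring G := seq_mset [seq (g * h)%g | h <- enum_mset m].
Definition gs_ract m g : group_semiring G := seq_mset [seq (h * g)%g | h <- enum_mset m].

End GroupSemiring.

Record skewTract := SkewTract {
  tunit : groupType;
  nullset : set (group_semiring tunit);
  teps : tunit;
  nullset0 : nullset 0;
  nullset1 : ~ nullset (gs_gen 1%g);
  nullset_eps : nullset (gs_gen 1%g + gs_gen teps);
  nullset_eps_uniq :
    forall e : tunit, nullset (gs_gen 1%g + gs_gen e) -> e = teps;
  nullset_lact : forall g m, nullset m -> nullset (gs_lact g m);
  nullset_ract : forall g m, nullset m -> nullset (gs_ract m g)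
}.

(* T = G u {0}, with None in the role of 0 *)
Definition tsort (T : skewTract) : Type := option (tunit T).
Coercion tsort : skewTract >-> Sortclass.
HB.instance Definition _ (T : skewTract) := Choice.on (tsort T).

Variant side := LeftSide | RightSide.

Section TractOperations.
Variable T : skewTract.
Implicit Types (x y : T) (s : side).

Definition tzero : T := None.
Definition tgen (g : tunit T) : T := Some g.
Definition tone : T := tgen 1%g.

Definition tmul x y : T :=
  if (x, y) is (Some g, Some h) then tgen (g * h)%g else tzero.
Definition topp x : T := tmul (tgen (teps T)) x.
(* the value at zero is irrelevant *)
Definition tinv x : T := if x is Some g then tgen g^-1%g else tzero.

(* the inclusion of T into N[G] *)
Definition tinj x : group_semiring (tunit T) :=
  if x is Some g then gs_gen g else 0.

(* The right-handed notions are the left-handed ones with all products        *)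
(* reversed; [smul s] is the product of T in the order prescribed by s.       *)
Definition smul s x y : T := if s is LeftSide then tmul x y else tmul y x.

End TractOperations.

Arguments tzero {T}.
Arguments tone {T}.

Section Modular.
Variable E : finType.
Implicit Types (D K : {set {set E}}) (A : {set E}).

Definition unions D : {set {set E}} := [set cover S | S in powerset D].

Definition chain K : bool :=
  [forall A in K, forall B in K, (A \subset B) || (B \subset A)].

Definition height D A : nat :=
  \max_(K : {set {set E}} |
          [&& K \subset unions D, chain K & [forall B in K, B \subset A]])
     #|K|.-1.

Definition modular D (fam : seq {set E}) : Prop :=
  {subset fam <= D} /\ height D (\bigcup_(A <- fam) A) = size fam.

End Modular.

Record matroid (E : finType) := Matroid {
  bases : {set {set E}};
  bases_neq0 : bases != set0;
  bases_exchange : forall (B B' : {set E}) (x : E),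
    B \in bases -> B' \in bases -> x \in B :\: B' ->
    exists2 y, y \in B' :\: B & y |: (B :\ x) \in bases
}.

Section MatroidTheory.
Variables (E : finType) (N : matroid E).
Implicit Types (A : {set E}).

(* all bases have the same size *)
Definition mrank : nat := \max_(B in bases N) #|B|.
Definition independent A : bool := [exists B in bases N, A \subset B].
Definition circuits : {set {set E}} :=
  [set A | minset (fun A' => ~~ independent A') A].

Definition adjacent : {set {set E} * {set E}} :=
  [set p | [&& p.1 \in bases N, p.2 \in bases N & #|p.1 :\: p.2| == 1%N]].

End MatroidTheory.

Section TMatroids.
Variables (E : finType) (T : skewTract).
Implicit Types (s : side) (X Y Z : {ffun E -> T}) (C : set {ffun E -> T}).
Implicit Types (N : matroid E).

Definition supp X : {set E} := [set e | X e != tzero].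
Definition supports C : {set {set E}} :=
  [set A | `[< exists2 X, C X & supp X = A >]].

Definition vscale s (x : T) X : {ffun E -> T} := [ffun e => smul s x (X e)].

Definition modular_family C (fam : seq {ffun E -> T}) : Prop :=
  (forall X, X \in fam -> C X) /\ modular (supports C) [seq supp X | X <- fam].

Record strong_matroid s C : Prop := StrongMatroid {
  circ_neq0 : ~ C [ffun=> tzero];
  circ_scale : forall X (a : tunit T), C X -> C (vscale s (tgen a) X);
  circ_incomp : forall X Y, C X -> C Y -> supp X \subset supp Y ->
    exists a : tunit T, Y = vscale s (tgen a) X;
  circ_elim : forall (k : nat) (Xs : 'I_k -> {ffun E -> T}) X (e : 'I_k -> E),
    modular_family C (X :: [seq Xs i | i : 'I_k]) ->
    ~~ (supp X \subset \bigcup_i supp (Xs i)) ->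
    (forall i, e i \in (supp X :&: supp (Xs i))
                         :\: \bigcup_(j | j != i) supp (Xs j)) ->
    (forall i, X (e i) = topp (Xs i (e i)) /\ X (e i) != tzero) ->
    exists Z, [/\ C Z, (forall i, Z (e i) = tzero) &
      forall f, nullset (tinj (X f) + \sum_i tinj (Xs i f) + tinj (topp (Z f)))]
}.

(* A map A_N -> T is represented by a total function on pairs of sets, of     *)
(* which only the values on [adjacent N] are ever used.                       *)
Implicit Types br : {set E} * {set E} -> T.

Definition exchangeable N (I J : {set E}) : {set E} :=
  [set x in I | (I :\ x \in bases N) && (x |: J \in bases N)].

Record quasi_plucker s N br : Prop := QuasiPlucker {
  qp_inv : forall (F : {set E}) a b,
    a \notin F -> b \notin F -> a != b ->
    #|F|.+1 = mrank N -> a |: F \in bases N -> b |: F \in bases N ->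
    smul s (br (a |: F, b |: F)) (br (b |: F, a |: F)) = tone;
  qp_triangle : forall (F : {set E}) a b c,
    a \notin F -> b \notin F -> c \notin F -> uniq [:: a; b; c] ->
    #|F|.+2 = mrank N ->
    let Fab := F :|: [set a; b] in
    let Fac := F :|: [set a; c] in
    let Fbc := F :|: [set b; c] in
    Fab \in bases N -> Fac \in bases N -> Fbc \in bases N ->
    smul s (smul s (br (Fac, Fbc)) (br (Fab, Fac))) (br (Fbc, Fab))
      = topp tone;
  qp_cocycle : forall (F : {set E}) a b c,
    a \notin F -> b \notin F -> c \notin F -> uniq [:: a; b; c] ->
    #|F|.+1 = mrank N ->
    a |: F \in bases N -> b |: F \in bases N -> c |: F \in bases N ->
    smul s (smul s (br (a |: F, b |: F)) (br (b |: F, c |: F)))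
      (br (c |: F, a |: F)) = tone;
  qp_cross : forall I J : {set E},
    #|I| = (mrank N).+1 -> #|J|.+1 = mrank N -> (3 <= #|I :\: J|)%N ->
    forall a b, a != b -> exchangeable N I J = [set a; b] ->
    br (I :\ a, I :\ b) = br (b |: J, a |: J);
  qp_exchange : forall I J : {set E},
    #|I| = (mrank N).+1 -> #|J|.+1 = mrank N -> (3 <= #|I :\: J|)%N ->
    (3 <= #|exchangeable N I J|)%N ->
    forall z, z \in exchangeable N I J ->
    nullset (tinj (topp tone) +
      \sum_(x in exchangeable N I J :\ z)
         tinj (smul s (br (I :\ x, I :\ z)) (br (x |: J, z |: J))))
}.

(* X may be any element of C with a, b \in supp X \subset Fab; the choice is  *)
(* immaterial for a strong matroid C, by [circ_incomp].                        *)
Definition bracket_of s C (p : {set E} * {set E}) : T :=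
  xget tzero (fun t : T => exists (F : {set E}) a b X,
    [/\ a \notin F, b \notin F & p = (a |: F, b |: F)] /\
    [/\ C X, [set a; b] \subset supp X, supp X \subset a |: (b |: F) &
        t = topp (smul s (tinv (X a)) (X b))]).

Definition circuits_of s N br : set {ffun E -> T} := fun X =>
  supp X \in circuits N /\
  forall (F : {set E}) a b,
    a \notin F -> b \notin F -> (a |: F, b |: F) \in adjacent N ->
    [set a; b] \subset supp X -> supp X \subset a |: (b |: F) ->
    smul s (tinv (X a)) (X b) = topp (br (a |: F, b |: F)).

End TMatroids.

(* Main.v *)
Require Import Defs.
From mathcomp Require Import boolp classical_sets.
From mathcomp Require Import all_boot all_algebra finmap multiset zify.

(* Both conditions say that the circuits of [C] are orthogonal to the         *)
(* cocircuits read off the bracket: for J of rank r - 1 the vector            *)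
(* y |-> [Jy, Jz] is supported off the hyperplane spanned by J, and (P4)',    *)
(* (P5)' assert that its pairing with the circuit contained in I is null.     *)
(* From (1), strong elimination expands a circuit X along the fundamental     *)
(* circuits of a basis Jz; the coordinate of this expansion at z is the       *)
(* required pairing, and (P3), (P4)', (P5)' are instances of it.  From (2),   *)
(* (P1) and (P2) provide a vector on every circuit of N, and (P4)' with       *)
(* J = I \ {a, b} makes its ratios independent of the set I containing the    *)
(* circuit.  To eliminate e_1, ..., e_k in a modular family with union A and  *)
(* g a private element of X, one takes the circuit Z in the complement of the *)
(* e_i in A; since A \ {g, e_1, ..., e_k} is independent, for each f in it    *)
(* there is a cocircuit meeting A inside {f, g, e_1, ..., e_k}, and pairing   *)
(* it with X, the X_i and Z gives the null sum at f.                          *)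

Set Implicit Arguments.
Unset Strict Implicit.
Unset Printing Implicit Defensive.

Import GRing.Theory.

(** The bridge between the two conditions is [cocircuit_orthogonal]: a vector X on a circuit has
    null pairing with every vector [cocircuit N br J z]. A circuit inside a set I of size r + 1
    meets the cocircuit of J exactly in the exchangeable elements of I and J, so [orthogonal_sum]
    identifies the pairing, up to a unit, with the sum in (P5)'; when only two elements are common
    it is the equation (P4)'. From circuits to coordinates, strong elimination enters only in
    [basis_expansion]; [strong_orthogonal] reads off one coordinate of it and [strong_quasi_plucker]
    specializes the result. From coordinates to circuits, [circuits_of_exists] realizes every
    circuit, [circuits_of_orthogonal] proves the pairings null, and [modular_elim] combines k + 2 of
    them into an elimination. Modularity is handled by counting: heights in the lattice of unions of
    circuits are bounded above by nullity ([height_nullity]) and below by private elements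
    ([ears_height]). *)

(** * Bases, circuits and the nullity bound on heights *)

Section Matroid.
Variables (E : finType) (N : matroid E).
Implicit Types (A B I J S U W F : {set E}) (K : {set {set E}}).

Lemma basis_card_eq B B' : B \in bases N -> B' \in bases N -> #|B| = #|B'|.
Proof.
move: {2}_.+1 (ltnSn #|B :\: B'|) => n; elim: n B => // n IH B ltn bB bB'.
have [BB'|/subsetPn[x xB xB']] := boolP (B \subset B').
  have [B'B|/subsetPn[x xB' xB]] := boolP (B' \subset B).
    by congr #|pred_of_set _|; apply/eqP; rewrite eqEsubset BB'.
  have [|y] := bases_exchange bB' bB (x := x); first by rewrite inE xB xB'.
  by rewrite inE => /andP[/negP yB' /(subsetP BB')].
have [|y] := bases_exchange bB bB' (x := x); first by rewrite inE xB xB'.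
rewrite inE => /andP[yB yB'] b1; rewrite -(IH (y |: B :\ x)) //; last first.
  rewrite -ltnS; apply: leq_trans ltn; rewrite ltnS; apply: proper_card.
  apply/properP; split; last by exists x; rewrite !inE ?xB ?xB' ?eqxx // orbF;
    apply: contraNN xB' => /eqP->.
  apply/subsetP => z; rewrite !inE => /andP[zB' /orP[/eqP zy|/andP[_ ->]]].
    by rewrite zy yB' in zB'.
  by rewrite zB'.
by rewrite cardsU1 !inE (negPf yB) andbF /= (cardsD1 x B) xB.
Qed.

Lemma basis_card B : B \in bases N -> #|B| = mrank N.
Proof.
move=> bB; apply/eqP; rewrite eqn_leq leq_bigmax_cond //=.
by apply/bigmax_leqP => B' bB'; rewrite (basis_card_eq bB bB').
Qed.

Lemma basis_independent B : B \in bases N -> independent N B.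
Proof. by move=> bB; apply/existsP; exists B; rewrite bB subxx. Qed.

Lemma independentS A A' : A \subset A' -> independent N A' -> independent N A.
Proof.
move=> AA' /existsP[B /andP[bB A'B]]; apply/existsP; exists B.
by rewrite bB (subset_trans AA').
Qed.

Lemma independent_card A : independent N A -> #|A| <= mrank N.
Proof. by case/existsP=> B /andP[bB /subset_leq_card]; rewrite (basis_card bB). Qed.

(** Among the bases containing A, one with the fewest elements outside A and B has none: such an
    element could be exchanged for one of B. *)
Lemma basis_extend A B : independent N A -> B \in bases N ->
  exists B', [/\ B' \in bases N, A \subset B' & B' \subset A :|: B].
Proof.
move=> /existsP[B0 /andP[bB0 AB0]] bB.
have [|B' /andP[bB' AB'] minB'] := arg_minnP
  (P := fun B' => (B' \in bases N) && (A \subset B'))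
  (fun B' : {set E} => #|B' :\: (A :|: B)|) (i0 := B0).
  by rewrite bB0.
exists B'; split=> //; apply/subsetP => x xB'; apply: contraT => xAB.
have [|y yB by_] := bases_exchange bB' bB (x := x).
  by move: xAB; rewrite !inE xB'; case: (x \in B); rewrite ?orbT.
have Ay : A \subset y |: (B' :\ x).
  apply/subsetP => z zA; rewrite !inE (subsetP AB' _ zA) andbT orbC.
  by apply/orP; left; apply: contraNN xAB => /eqP <-; rewrite inE zA.
have := minB' (y |: (B' :\ x)); rewrite by_ Ay => /(_ isT).
rewrite leqNgt => /negP[]; apply: proper_card; apply/properP; split.
  apply/subsetP => z; rewrite !inE => /andP[zAB].
  case/orP=> [/eqP zy|/andP[_ ->]]; last by rewrite zAB.
  by move: zAB yB; rewrite zy !inE => /norP[_ /negP yB] /andP[_ /yB].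
exists x; first by rewrite inE xAB.
rewrite !inE eqxx /= orbF; apply/negP => /andP[_ /eqP xy].
by move: xAB yB; rewrite xy !inE => /norP[_ /negP yB] /andP[_ /yB].
Qed.

Lemma circuit_dep S : S \in circuits N -> ~~ independent N S.
Proof. by rewrite inE => /minsetp. Qed.

Lemma circuit_nbasis S : S \in circuits N -> forall B, B \in bases N -> ~~ (S \subset B).
Proof.
move=> cS B bB; apply: contra (circuit_dep cS) => SB.
exact: independentS SB (basis_independent bB).
Qed.

Lemma circuitD1 S x : S \in circuits N -> x \in S -> independent N (S :\ x).
Proof.
rewrite inE => /minsetP[_ minS] xS; apply: contraT => /minS/(_ (subsetDl _ _)) e.
by move: xS; rewrite -e !inE eqxx.
Qed.

Lemma circuit_sub_indep S A : S \in circuits N -> A \proper S -> independent N A.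
Proof.
move=> cS /properP[AS [x xS xA]]; apply: independentS (circuitD1 cS xS).
by rewrite subsetD1 AS.
Qed.

Lemma circuit_incomp S S' : S \in circuits N -> S' \in circuits N ->
  S \subset S' -> S = S'.
Proof.
move=> cS cS' SS'; apply/eqP; apply: contraNT (circuit_dep cS) => neq.
by apply: circuit_sub_indep cS' _; rewrite properEneq neq.
Qed.

Lemma circuit_neq0 S : S \in circuits N -> S != set0.
Proof.
move=> cS; apply: contraTneq (circuit_dep cS) => ->; rewrite negbK.
have /set0Pn[B bB] := bases_neq0 N.
by apply: independentS (basis_independent bB); apply: sub0set.
Qed.

Lemma dep_circuit A : ~~ independent N A ->
  exists2 S, S \in circuits N & S \subset A.
Proof.
by move=> dA; have [S mS SA] := @minset_exists _ (fun A' => ~~ independent N A') A dA; exists S; rewrite ?inE.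
Qed.

Lemma basisU1_dep B y : B \in bases N -> y \notin B -> ~~ independent N (y |: B).
Proof.
move=> bB yB; apply/negP => /independent_card.
by rewrite cardsU1 yB (basis_card bB) ltnn.
Qed.

Lemma fundamental_circuit B y : B \in bases N -> y \notin B ->
  exists S, [/\ S \in circuits N, y \in S & S \subset y |: B].
Proof.
move=> bB yB; have [S cS SyB] := dep_circuit (basisU1_dep bB yB).
exists S; split=> //; apply: contraNT (circuit_nbasis cS bB) => yS.
by apply/subsetP => x xS; have := subsetP SyB _ xS; rewrite !inE;
  case/orP=> [/eqP xy|//]; rewrite -xy xS in yS.
Qed.

Lemma spanning_remove W B S x : B \in bases N -> B \subset W ->
  S \in circuits N -> S \subset W -> x \in S ->
  exists2 B', B' \in bases N & B' \subset W :\ x.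
Proof.
move=> bB BW cS SW xS; have [B' [bB' SB' B'W]] := basis_extend (circuitD1 cS xS) bB.
exists B' => //; rewrite subsetD1; apply/andP; split.
  apply: subset_trans B'W _; rewrite subUset BW andbT.
  exact: subset_trans (subsetDl _ _) SW.
apply: contraNN (circuit_nbasis cS bB') => xB'.
by rewrite -(setD1K xS) subUset sub1set xB'.
Qed.

Lemma circuit_basis_mem S (I : {set E}) x : S \in circuits N -> S \subset I ->
  I :\ x \in bases N -> x \in S.
Proof.
move=> cS SI bI; apply: contraNT (circuit_nbasis cS bI) => xS.
by rewrite subsetD1 SI.
Qed.

(** Removing an element of a circuit from I keeps I spanning, and I has just one element more than a
    basis. *)
Lemma circuit_basis_rem S (I : {set E}) e x : S \in circuits N -> S \subset I ->
  e \in I -> I :\ e \in bases N -> x \in S -> I :\ x \in bases N.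
Proof.
move=> cS SI eI bI xS.
have [B' bB' B'I] := spanning_remove bI (subsetDl _ _) cS SI xS.
suff <- : B' = I :\ x by [].
apply/eqP; rewrite eqEcard B'I (basis_card bB') -(basis_card bI).
by move: (cardsD1 x I) (cardsD1 e I); rewrite (subsetP SI) // eI; lia.
Qed.

Lemma circuit_unique S S' (I : {set E}) e : S \in circuits N -> S \subset I ->
  S' \in circuits N -> S' \subset I -> e \in I -> I :\ e \in bases N -> S = S'.
Proof.
move=> cS SI cS' S'I eI bI; apply: circuit_incomp => //; apply/subsetP => x xS.
by apply: circuit_basis_mem cS' S'I _; apply: circuit_basis_rem bI xS.
Qed.

(** Such an I, a basis extending S minus a point together with that point, makes all brackets
    attached to S available inside a single set. *)
Lemma circuit_span S : S \in circuits N ->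
  exists2 I : {set E}, S \subset I & forall x, x \in S -> I :\ x \in bases N.
Proof.
move=> cS; have /set0Pn[x0 x0S] := circuit_neq0 cS.
have /existsP[B /andP[bB SB]] := circuitD1 cS x0S.
have x0B : x0 \notin B.
  apply: contraNN (circuit_nbasis cS bB) => x0B.
  by rewrite -(setD1K x0S) subUset sub1set x0B.
have SI : S \subset x0 |: B by rewrite -(setD1K x0S) setUS.
exists (x0 |: B) => // x xS.
apply: (circuit_basis_rem cS SI (e := x0)) => //; first by rewrite setU11.
by rewrite setU1K.
Qed.

(* The y with J + y a basis form a cocircuit. *)
Lemma circuit_cocircuit S J x : S \in circuits N -> x \in S ->
  x \notin J -> x |: J \in bases N ->
  exists y, [/\ y \in S, y != x, y \notin J & y |: J \in bases N].
Proof.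
move=> cS xS xJ bJ.
have [B' [bB' SB' B'J]] := basis_extend (circuitD1 cS xS) bJ.
have xB' : x \notin B'.
  apply: contraNN (circuit_nbasis cS bB') => xB'.
  by rewrite -(setD1K xS) subUset sub1set xB'.
have [|y] := bases_exchange bJ bB' (x := x); first by rewrite !inE eqxx xB'.
rewrite setU1K // !inE => /andP[/norP[yx yJ] yB'] by_.
exists y; split=> //; have := subsetP B'J _ yB'.
by rewrite !inE (negPf yJ) (negPf yx) /= orbF.
Qed.

Lemma basisU1_notin F x : x |: F \in bases N -> #|F|.+1 = mrank N -> x \notin F.
Proof.
move=> bF cF; apply/negP => xF.
have := basis_card bF; rewrite cardsU1 xF -cF add0n => /eqP.
by rewrite eqn_leq ltnn andbF.
Qed.

Lemma basisU1_card F x : x \notin F -> x |: F \in bases N -> #|F|.+1 = mrank N.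
Proof. by move=> xF /basis_card; rewrite cardsU1 xF. Qed.

Lemma unions_sub U x : U \in unions (circuits N) -> x \in U ->
  exists S, [/\ S \in circuits N, x \in S & S \subset U].
Proof.
case/imsetP=> P; rewrite inE => /subsetP sP -> /bigcupP[S SP xS].
by exists S; split; rewrite ?sP //; apply: bigcup_sup.
Qed.

(* Every strict step of a chain of unions of circuits allows the removal of   *)
(* an element of W without destroying its rank, so that the length of the     *)
(* chain is bounded by the nullity of W.                                      *)
Lemma chain_nullity K W B : B \in bases N -> B \subset W ->
  K \subset unions (circuits N) -> chain K -> (forall U, U \in K -> U \subset W) ->
  #|K|.-1 + mrank N <= #|W|.
Proof.
move: {2}_.+1 (ltnSn #|K|) => n; elim: n K W B => // n IH K W B ltn bB BW KC cK KW.
have [K1|K1] := leqP #|K| 1.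
  have -> : #|K|.-1 = 0 by apply/eqP; rewrite -leqn0 -ltnS; case: #|K| K1.
  by rewrite -(basis_card bB) add0n subset_leq_card.
have [U0 U0K] : exists U, U \in K.
  by apply/set0Pn; rewrite -card_gt0; apply: ltnW K1.
have [U UK maxU] := arg_maxnP (fun A => #|A|) U0K.
have sub A A' : A \in K -> A' \in K -> #|A| <= #|A'| -> A \subset A'.
  move=> AK A'K leA; move/forallP: cK => /(_ A)/implyP/(_ AK)/forallP/(_ A').
  move=> /implyP/(_ A'K)/orP[//|A'A].
  by have /eqP -> : A' == A by rewrite eqEcard A'A leA.
have cK' : #|K| = #|K :\ U|.+1 by rewrite (cardsD1 U K) (_ : U \in K).
have K'0 : 0 < #|K :\ U| by rewrite -ltnS -cK'.
have [V0 V0K] : exists V, V \in K :\ U by apply/set0Pn; rewrite -card_gt0.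
(* V is the second largest member of the chain. A point x of U outside V avoids every member of K
   other than U, so the induction applies to W without x. *)
have [V VKU maxV] := arg_maxnP (fun A => #|A|) V0K.
have /setD1P[VU VK] := VKU.
have VsU : V \proper U by rewrite properEneq VU; apply: sub VK UK (maxU V VK).
have /properP[_ [x xU xV]] := VsU.
have [S [cS xS SU]] := unions_sub (subsetP KC _ UK) xU.
have [B' bB' B'W] := spanning_remove bB BW cS (subset_trans SU (KW _ UK)) xS.
rewrite cK' /= (cardsD1 x W) (subsetP (KW _ UK)) // add1n.
rewrite -(prednK K'0) addSn ltnS; apply: (IH _ _ B') => //.
- by rewrite -cK' -ltnS.
- exact: subset_trans (subsetDl _ _) KC.
- 
  apply/forallP => A; apply/implyP; rewrite in_setD1 => /andP[_ AK].
  apply/forallP => A'; apply/implyP; rewrite in_setD1 => /andP[_ A'K].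
  by move/forallP: cK => /(_ A)/implyP/(_ AK)/forallP/(_ A')/implyP/(_ A'K).
- move=> A AKU; have /setD1P[AU AK] := AKU.
rewrite subsetD1 KW //=; apply: contraNN xV => xA.
by apply: (subsetP (sub A V AK VK _)) => //; apply: maxV.
Qed.

Lemma height_nullity A W B : B \in bases N -> B \subset W -> A \subset W ->
  height (circuits N) A + mrank N <= #|W|.
Proof.
move=> bB BW AW.
have le0 : mrank N <= #|W| by rewrite -(basis_card bB) subset_leq_card.
suff : height (circuits N) A <= #|W| - mrank N by lia.
apply/bigmax_leqP => K /and3P[KC cK /forallP KA].
have KW U : U \in K -> U \subset W.
  by move=> UK; apply: subset_trans AW; have := KA U; rewrite UK.
by have := chain_nullity bB BW KC cK KW; lia.
Qed.

End Matroid.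

(** * Lower bounds for heights of unions *)

Section Ears.
Variable E : finType.
Implicit Types (D : {set {set E}}) (A : {set E}) (s : seq {set E}).

(** As in an ear decomposition, each set adds a point to the union of the later ones, so the unions
    of the tails increase strictly from the end of the list. *)
Fixpoint ears s : bool :=
  if s is A :: s' then ~~ (A \subset \bigcup_(B <- s') B) && ears s' else true.

Lemma unions_bigcup D s : {subset s <= D} -> \bigcup_(A <- s) A \in unions D.
Proof.
move=> sD; apply/imsetP; exists [set A in s].
  by rewrite inE; apply/subsetP => A; rewrite inE => /sD.
rewrite /cover; apply/setP => x; apply/idP/bigcupP.
  by rewrite bigcup_seq => /bigcupP[A As xA]; exists A; rewrite ?inE.
by case=> A; rewrite inE => As xA; rewrite bigcup_seq; apply/bigcupP; exists A.
Qed.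

(** The unions of the tails, the empty one included, form a chain with one member more than the
    list; [height] subtracts that one. *)
Lemma ears_height D s A : {subset s <= D} -> ears s ->
  \bigcup_(B <- s) B \subset A -> size s <= height D A.
Proof.
move=> sD es sA.
suff [K [KD cK KA cardK]] : exists K : {set {set E}},
  [/\ K \subset unions D, chain K, forall B, B \in K -> B \subset \bigcup_(B <- s) B
   & #|K| = (size s).+1].
  rewrite -[size s]/((size s).+1.-1) -cardK; apply: leq_bigmax_cond (fun K => _) _ _.
  rewrite KD cK; apply/forallP => B; apply/implyP => /KA BA.
  exact: subset_trans BA sA.
elim: s sD es {sA} => [_ _|S s IH sD /= /andP[nS es]].
  exists [set set0]; split; rewrite ?cards1 //.
  - apply/subsetP => B; rewrite inE => /eqP->.
    by have := @unions_bigcup D [::]; rewrite big_nil; apply.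
  - apply/forallP => B; apply/implyP; rewrite inE => /eqP->.
    by apply/forallP => B'; apply/implyP; rewrite sub0set.
  by move=> B; rewrite inE => /eqP->; rewrite sub0set.
have [|K [KD cK KA cardK]] := IH _ es.
  by move=> B Bs; apply: sD; rewrite inE Bs orbT.
set V := \bigcup_(B <- S :: s) B.
have sV : \bigcup_(B <- s) B \subset V by rewrite /V big_cons subsetUr.
exists (V |: K); split.
- apply/subsetP => B; rewrite !inE => /orP[/eqP->|/(subsetP KD)//].
  exact: unions_bigcup.
- apply/forallP => B; apply/implyP; rewrite !inE => /orP[/eqP->|BK];
    apply/forallP => B'; apply/implyP; rewrite !inE => /orP[/eqP->|B'K].
  + by rewrite subxx.
  + by rewrite (subset_trans (KA _ B'K) sV) orbT.
  + by rewrite (subset_trans (KA _ BK) sV).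
  by move/forallP: cK => /(_ B)/implyP/(_ BK)/forallP/(_ B')/implyP/(_ B'K).
- by move=> B; rewrite !inE => /orP[/eqP->//|/KA BA]; apply: subset_trans sV.
rewrite cardsU1 cardK; case: (boolP (V \in K)) => //= /KA.
by rewrite /V big_cons subUset (negPf nS).
Qed.

End Ears.

Local Open Scope ring_scope.

(** * Translations of the group semiring *)

Section Semiring.
Variable G : groupType.
Implicit Types (g h : G) (m n : group_semiring G).

Lemma seq_mset_cat (s t : seq G) : seq_mset (s ++ t) = (seq_mset s `+` seq_mset t)%mset.
Proof. by apply/msetP => g; rewrite msetE2 !mset_seqE count_cat. Qed.

Lemma perm_enum_msetD m n :
  perm_eq (enum_mset (m + n : group_semiring G)) (enum_mset m ++ enum_mset n).
Proof.
by apply/eq_seq_msetP; rewrite seq_mset_cat !seq_mset_id.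
Qed.

Lemma gs_lactD g : {morph gs_lact g : m n / m + n}.
Proof.
move=> m n; rewrite /gs_lact -[RHS]seq_mset_cat -map_cat.
by apply/eq_seq_msetP/perm_map/perm_enum_msetD.
Qed.

Lemma gs_ractD g : {morph (fun m => gs_ract m g) : m n / m + n}.
Proof.
move=> m n; rewrite /gs_ract -[RHS]seq_mset_cat -map_cat.
by apply/eq_seq_msetP/perm_map/perm_enum_msetD.
Qed.

Lemma gs_lact0 g : gs_lact g 0 = 0.
Proof. by rewrite /gs_lact enum_mset0 /=; apply/msetP => h; rewrite mset_seqE mset0E. Qed.

Lemma gs_ract0 g : gs_ract 0 g = 0.
Proof. by rewrite /gs_ract enum_mset0 /=; apply/msetP => h; rewrite mset_seqE mset0E. Qed.

Lemma gs_lact_gen g h : gs_lact g (gs_gen h) = gs_gen (g * h)%g.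
Proof.
rewrite /gs_lact /gs_gen enum_msetn /=; apply/msetP => k.
by rewrite mset_seqE /= addn0 msetnE eq_sym; case: eqP.
Qed.

Lemma gs_ract_gen g h : gs_ract (gs_gen h) g = gs_gen (h * g)%g.
Proof.
rewrite /gs_ract /gs_gen enum_msetn /=; apply/msetP => k.
by rewrite mset_seqE /= addn0 msetnE eq_sym; case: eqP.
Qed.

End Semiring.

(** * Arithmetic of a skew tract, for both orders of multiplication *)

Section Tract.
Variables (T : skewTract) (s : side).
Implicit Types (x y z : T) (g : tunit T).

Local Notation "x ** y" := (smul s x y) (at level 40, left associativity).

Lemma smulA x y z : x ** (y ** z) = x ** y ** z.
Proof.
by case: s x y z => [] [x|] [y|] [z|] //=; rewrite /tmul /= ?mulgA.
Qed.

Lemma smul1 x : x ** tone = x.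
Proof. by case: s x => [] [x|] //=; rewrite /tmul /= ?(mulg1, mul1g). Qed.

Lemma s1mul x : tone ** x = x.
Proof. by case: s x => [] [x|] //=; rewrite /tmul /= ?(mulg1, mul1g). Qed.

Lemma smul0 x : x ** tzero = tzero.
Proof. by case: s x => [] [x|]. Qed.

Lemma s0mul x : tzero ** x = tzero.
Proof. by case: s x => [] [x|]. Qed.

Lemma smulV x : x != tzero -> x ** tinv x = tone.
Proof. by case: s x => [] [x|] //= _; rewrite /tmul /= ?(mulgV, mulVg). Qed.

Lemma sVmul x : x != tzero -> tinv x ** x = tone.
Proof. by case: s x => [] [x|] //= _; rewrite /tmul /= ?(mulgV, mulVg). Qed.

Lemma smul_eq0 x y : (x ** y == tzero) = (x == tzero) || (y == tzero).
Proof. by case: s x y => [] [x|] [y|]. Qed.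

Lemma tinv_eq0 x : (tinv x == tzero) = (x == tzero).
Proof. by case: x. Qed.

Lemma tinvM x y : tinv (x ** y) = tinv y ** tinv x.
Proof. by case: s x y => [] [x|] [y|] //=; rewrite /tmul /= invgM. Qed.

Lemma tinvK : involutive (@tinv T).
Proof. by case=> [x|] //=; rewrite invgK. Qed.

Lemma smulK x y : x != tzero -> y ** x ** tinv x = y.
Proof. by move=> x0; rewrite -smulA smulV // smul1. Qed.

Lemma smulVK x y : x != tzero -> y ** tinv x ** x = y.
Proof. by move=> x0; rewrite -smulA sVmul // smul1. Qed.

Lemma sKmul x y : x != tzero -> tinv x ** (x ** y) = y.
Proof. by move=> x0; rewrite smulA sVmul // s1mul. Qed.

Lemma sVKmul x y : x != tzero -> x ** (tinv x ** y) = y.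
Proof. by move=> x0; rewrite smulA smulV // s1mul. Qed.

Lemma smul1_inv x y : x ** y = tone -> y = tinv x.
Proof.
move=> xy; have x0 : x != tzero.
  by apply: contra_eqN xy => /eqP->; rewrite s0mul.
by rewrite -[y](sKmul _ x0) xy smul1.
Qed.

Lemma neq0_tgen x : x != tzero -> exists g, x = tgen g.
Proof. by case: x => [g|//] _; exists g. Qed.

(** Right translation by the inverse of g reduces to the defining uniqueness of epsilon. Both
    [tepsK] and [tepsC] follow by exhibiting suitable two-term null sums. *)
Lemma teps_unique g h : nullset (gs_gen g + gs_gen h) -> h = (teps T * g)%g.
Proof.
move=> /(nullset_ract g^-1%g); rewrite gs_ractD !gs_ract_gen mulgV.
by move/nullset_eps_uniq => <-; rewrite mulgVK.
Qed.

Lemma nullset_tepsM g : nullset (gs_gen g + gs_gen (teps T * g)%g).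
Proof.
by have := nullset_ract g (nullset_eps T); rewrite gs_ractD !gs_ract_gen mul1g.
Qed.

Lemma tepsK : (teps T * teps T = 1)%g.
Proof. by symmetry; apply: teps_unique; rewrite addrC; apply: nullset_eps. Qed.

Lemma tepsC g : (g * teps T = teps T * g)%g.
Proof.
apply: teps_unique.
by have := nullset_lact g (nullset_eps T); rewrite gs_lactD !gs_lact_gen mulg1.
Qed.

Lemma toppK : involutive (@topp T).
Proof. by case=> [x|] //; rewrite /topp /tmul /= mulgA tepsK mul1g. Qed.

Lemma toppM x y : topp x ** y = topp (x ** y).
Proof.
by case: s x y => [] [x|] [y|] //=; rewrite /topp /tmul /= !mulgA ?tepsC.
Qed.

Lemma smulN x y : x ** topp y = topp (x ** y).
Proof.
by case: s x y => [] [x|] [y|] //=; rewrite /topp /tmul /= !mulgA ?tepsC.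
Qed.

Lemma topp0 : topp (@tzero T) = tzero. Proof. by []. Qed.

Lemma topp_eq0 x : (topp x == tzero) = (x == tzero).
Proof. by case: x. Qed.

Lemma topp_inj : injective (@topp T).
Proof. exact: inv_inj toppK. Qed.

Lemma tinvN x : tinv (topp x) = topp (tinv x).
Proof.
case: x => [x|] //=; rewrite /topp /tmul /= invgM -tepsC.
by congr (Some (_ * _)%g); apply: (mulIg (teps T)); rewrite mulVg tepsK.
Qed.

Lemma nullset_scale x (I : Type) (r : seq I) (P : pred I) (F : I -> T) :
  nullset (\sum_(i <- r | P i) tinj (F i)) ->
  nullset (\sum_(i <- r | P i) tinj (x ** F i)).
Proof.
case: x => [g|] nF; last first.
  by rewrite big1 => [|i _]; [exact: nullset0 | rewrite s0mul].
have mulE h : tinj (tgen g ** h) =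
    if s is LeftSide then gs_lact g (tinj h) else gs_ract (tinj h) g.
  case: (s) h => [] [h|] /=; rewrite ?gs_lact_gen ?gs_ract_gen //.
    by rewrite gs_lact0.
  by rewrite gs_ract0.
under eq_bigr do rewrite mulE.
case: (s).
  rewrite -(big_morph _ (gs_lactD g) (gs_lact0 g)); exact: nullset_lact.
rewrite -(big_morph (fun m => gs_ract m g) (gs_ractD g) (gs_ract0 g)).
exact: nullset_ract.
Qed.

End Tract.

Section TractRight.
Variables (T : skewTract) (s : side).

(** Multiplying on the right for one side is multiplying on the left for the other, which reduces
    [nullset_scaler] to [nullset_scale]. *)
Definition other_side := if s is LeftSide then RightSide else LeftSide.

Lemma smul_other (x y : T) : smul other_side x y = smul s y x.
Proof. by rewrite /other_side; case: s. Qed.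

Lemma nullset_scaler (x : T) (I : Type) (r : seq I) (P : pred I) (F : I -> T) :
  nullset (\sum_(i <- r | P i) tinj (F i)) ->
  nullset (\sum_(i <- r | P i) tinj (smul s (F i) x)).
Proof.
move/(nullset_scale other_side x).
by under eq_bigr do rewrite smul_other.
Qed.

Lemma nullset_one (x : T) : nullset (tinj x) -> x = tzero.
Proof.
case: x => [g|//] /= /(nullset_lact g^-1%g); rewrite gs_lact_gen mulVg.
by move/nullset1.
Qed.

(** This turns two-term null sums into equations. When one entry is zero, the other must vanish too,
    because a single unit is never null. *)
Lemma nullset_two (x y : T) : nullset (tinj x + tinj y) <-> y = topp x.
Proof.
case: x y => [g|] [h|] /=; rewrite ?addr0 ?add0r; split=> //.
- by move=> /teps_unique ->.
- by case=> ->; apply: nullset_tepsM.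
- by move/(nullset_one (x := tgen g)).
- by move/(nullset_one (x := tgen h)).
- by move=> _; apply: nullset0.
Qed.

End TractRight.

(** * Ratios on circuits and pairings with cocircuits *)

Section Ratios.
Variables (E : finType) (N : matroid E) (T : skewTract) (s : side).
Implicit Types (F J S I : {set E}) (X Y Z : {ffun E -> T}) (a b x y z : E).
Implicit Types (br : {set E} * {set E} -> T) (C : set {ffun E -> T}).

Local Notation "x ** y" := (smul s x y) (at level 40, left associativity).

Lemma setU1U1D1 F a b : a \notin F -> b \notin F -> a != b ->
  (a |: (b |: F)) :\ a = b |: F /\ (a |: (b |: F)) :\ b = a |: F.
Proof.
move=> aF bF ab; split; first by rewrite setU1K // !inE negb_or ab.
by rewrite setUCA setU1K // !inE negb_or eq_sym ab.
Qed.

Lemma setD1D1U1 I a b : a \in I -> b \in I -> a != b ->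
  [/\ a \notin I :\ a :\ b, b \notin I :\ a :\ b,
      a |: (I :\ a :\ b) = I :\ b, b |: (I :\ a :\ b) = I :\ a
    & a |: (b |: (I :\ a :\ b)) = I].
Proof.
move=> aI bI ab; have ba : b \in I :\ a by rewrite !inE eq_sym ab.
have Ib : I :\ a :\ b = I :\ b :\ a by rewrite !setDDl setUC.
split; rewrite ?(setD1K ba) ?(setD1K aI) ?inE ?eqxx ?andbF //.
by rewrite Ib setD1K // !inE ab.
Qed.

Lemma adjacent_setU1 F a b : a \notin F -> b \notin F ->
  ((a |: F, b |: F) \in adjacent N) =
  [&& a |: F \in bases N, b |: F \in bases N & a != b].
Proof.
move=> aF bF; rewrite inE /=; congr [&& _, _ & _].
have -> : (a |: F) :\: (b |: F) = if a == b then set0 else [set a].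
  apply/setP => x; rewrite !inE; case: (eqVneq a b) => [->|ab].
    by rewrite inE; case: (_ == b); case: (x \in F).
  rewrite inE; case: (eqVneq x a) => [->|]; first by rewrite (negPf ab) aF.
  by case: (x \in F); rewrite ?orbT ?andbF //=; rewrite andbF.
by case: (eqVneq a b); rewrite ?cards0 ?cards1.
Qed.

Lemma adjacentP p : p \in adjacent N -> exists F a b,
  [/\ a \notin F, b \notin F, a != b & p = (a |: F, b |: F)].
Proof.
case: p => B B'; rewrite inE /= => /and3P[bB bB' /eqP c1].
have c2 : #|B' :\: B| = 1%N.
  have := cardsID B B'; have := cardsID B' B.
  by rewrite (basis_card bB) (basis_card bB') (setIC B' B) c1; lia.
have /cards1P[a Ba] := introT eqP c1; have /cards1P[b Bb] := introT eqP c2.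
have aBB : a \in B :\: B' by rewrite Ba inE.
have bBB : b \in B' :\: B by rewrite Bb inE.
exists (B :&: B'), a, b; rewrite !inE.
move: aBB bBB; rewrite !inE => /andP[aB' aB] /andP[bnB bB'2].
rewrite (negPf aB') (negPf bnB) andbF; split=> //.
  by apply: contraNneq bnB => <-.
by rewrite -Ba -Bb setUC setID setUC (setIC B) setID.
Qed.

(** F is the intersection of the two bases. Hence the only freedom left by the existential
    quantifiers of [bracket_of] is the vector X. *)
Lemma setU1_pair_inj F F' a b a' b' : a \notin F -> b \notin F ->
  a' \notin F' -> b' \notin F' -> a != b ->
  (a |: F, b |: F) = (a' |: F', b' |: F') -> [/\ F = F', a = a' & b = b'].
Proof.
move=> aF bF aF' bF' ab [eA eB].
have ab' : a' != b'.
  apply: contraNneq ab => e; have : a |: F = b |: F by rewrite eA eB e.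
  by move/setP/(_ a); rewrite !inE eqxx /= (negPf aF) orbF => /esym.
have capE (G : {set E}) c d : c \notin G -> d \notin G -> c != d ->
    (c |: G) :&: (d |: G) = G.
  move=> cG dG cd; apply/setP => x; rewrite !inE.
  case: (eqVneq x c) => [->|_]; first by rewrite (negPf cd) (negPf cG).
  by case: (x \in G); rewrite ?orbT //= andbF.
have eF : F = F' by rewrite -(capE F a b) // eA eB capE.
split=> //.
  by have := setU11 a F; rewrite eA -eF !inE (negPf aF) orbF => /eqP.
by have := setU11 b F; rewrite eB -eF !inE (negPf bF) orbF => /eqP.
Qed.

(** The condition of [circuits_of] written with I = Fab, so that Fa is I minus b and Fb is I minus
    a. *)
Definition ratios br X := forall I a b, a != b -> a \in supp X -> b \in supp X ->
  supp X \subset I -> I :\ a \in bases N -> I :\ b \in bases N ->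
  tinv (X a) ** X b = topp (br (I :\ b, I :\ a)).

Lemma circuits_ofP br X :
  circuits_of s N br X <-> supp X \in circuits N /\ ratios br X.
Proof.
split=> -[cX rX]; split=> //.
  move=> I a b ab aX bX XI bIa bIb.
  have [aI bI] := (subsetP XI _ aX, subsetP XI _ bX).
  move: (setD1D1U1 aI bI ab); set F := _ :\ b => -[aF bF eb ea eI].
  rewrite -eb -ea; apply: rX; rewrite ?eI ?adjacent_setU1 ?eb ?ea ?bIa ?bIb //.
  by apply/subsetP => x; rewrite in_set2 => /orP[]/eqP->.
move=> F a b aF bF; rewrite adjacent_setU1 // => /and3P[ba bb ab].
rewrite subUset !sub1set => /andP[aX bX] XI.
have [ea eb] := setU1U1D1 aF bF ab.
by rewrite (rX _ _ _ ab aX bX XI) ?ea ?eb.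
Qed.

Lemma suppE X x : (x \in supp X) = (X x != tzero).
Proof. by rewrite inE. Qed.

Lemma supp0 X x : x \notin supp X -> X x = tzero.
Proof. by rewrite inE negbK => /eqP. Qed.

Lemma supp_vscale (c : T) X : c != tzero -> supp (vscale s c X) = supp X.
Proof. by move=> c0; apply/setP => x; rewrite !inE ffunE smul_eq0 (negPf c0). Qed.

Lemma ratios_scale br (c : T) X : c != tzero -> ratios br X -> ratios br (vscale s c X).
Proof.
move=> c0 rX I a b ab; rewrite !supp_vscale // !ffunE => aX bX XI ba bb.
by rewrite tinvM -smulA sKmul // (rX I).
Qed.

(** Inside one set I from [circuit_span] the bracket prescribes every ratio to the entry at a, so
    that entry determines the whole vector. *)
Lemma ratios_eq br X Y a : supp X \in circuits N -> supp Y = supp X ->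
  ratios br X -> ratios br Y -> a \in supp X ->
  Y = vscale s (Y a ** tinv (X a)) X.
Proof.
move=> cX YX rX rY aX; apply/ffunP => b; rewrite ffunE.
have [aX0 aY0] : X a != tzero /\ Y a != tzero by rewrite -!suppE YX.
have [<-|ab] := eqVneq a b; first by rewrite smulVK.
have [bX|bX] := boolP (b \in supp X); last first.
  by rewrite (supp0 bX) smul0 supp0 // YX.
have [I XI bI] := circuit_span cX.
rewrite -smulA (rX I) ?bI // -(rY I) ?bI ?YX //.
by rewrite sVKmul.
Qed.

(* The cocircuit that vanishes on the hyperplane spanned by J, normalized     *)
(* to be 1 at z.                                                              *)
Definition cocircuit br J z y : T :=
  if y == z then tone else
  if y |: J \in bases N then br (y |: J, z |: J) else tzero.

(** The entry of X is the first factor: rescaling X acts on the outer side of each product and a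
    change of z on the other, and both actions preserve null sums. *)
Definition cocircuit_orthogonal br X := forall J z, z \notin J -> z |: J \in bases N ->
  nullset (\sum_y tinj (X y ** cocircuit br J z y)).

Lemma cocircuit_z br J z : cocircuit br J z z = tone.
Proof. by rewrite /cocircuit eqxx. Qed.

Lemma cocircuit_in br J z y : z \notin J -> z |: J \in bases N ->
  y \in J -> cocircuit br J z y = tzero.
Proof.
move=> zJ bz yJ; rewrite /cocircuit; case: eqP => [yz|_]; first by rewrite -yz yJ in zJ.
case: ifP => // /basisU1_notin/(_ (basisU1_card zJ bz)).
by rewrite yJ.
Qed.

(** The points whose removal from I leaves a basis are those of the circuit, so exchangeability
    means lying on both the circuit and the cocircuit of J. *)
Lemma in_exchangeable X I J y : supp X \in circuits N -> supp X \subset I ->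
  (forall x, x \in supp X -> I :\ x \in bases N) ->
  (y \in exchangeable N I J) = (y \in supp X) && (y |: J \in bases N).
Proof.
move=> cX XI bI; rewrite inE andbA; congr (_ && _).
apply/andP/idP => [[yI]|yX]; first exact: circuit_basis_mem cX XI.
by rewrite (subsetP XI) // bI.
Qed.

(* The null sums of (P4)' and (P5)' are pairings of circuits and cocircuits.  *)
Lemma orthogonal_sum br X I J z : supp X \in circuits N -> ratios br X ->
  supp X \subset I -> (forall x, x \in supp X -> I :\ x \in bases N) ->
  z \in supp X -> z |: J \in bases N ->
  nullset (\sum_y tinj (X y ** cocircuit br J z y)) <->
  nullset (tinj (topp (@tone T)) + \sum_(x in exchangeable N I J :\ z)
             tinj (br (I :\ x, I :\ z) ** br (x |: J, z |: J))).
Proof.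
move=> cX rX XI bI zX bz; have Xz0 : X z != tzero by rewrite -suppE.
(* Scaling by the negative inverse of X(z) makes the term at z equal to -1 and replaces each other
   X(y) on the support by the bracket of I minus y and I minus z. *)
pose H y := topp (tinv (X z)) ** (X y ** cocircuit br J z y).
have HE : \sum_y tinj (H y) = tinj (topp (@tone T)) +
    \sum_(x in exchangeable N I J :\ z)
             tinj (br (I :\ x, I :\ z) ** br (x |: J, z |: J)).
  rewrite (bigD1 z) //= /H cocircuit_z smul1 toppM sVmul //; congr (_ + _).
  rewrite [RHS]big_mkcond [LHS]big_mkcond; apply: eq_bigr => y _.
  rewrite in_setD1 (in_exchangeable J y cX XI bI) /cocircuit; case: eqVneq => //= yz.
  case: ifP => by_; last by rewrite !smul0 andbF.
  rewrite andbT; case: (boolP (y \in supp X)) => yX; last first.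
    by rewrite (supp0 yX) s0mul smul0.
  by rewrite smulA toppM (rX I) ?bI 1?eq_sym // toppK.
rewrite -HE; split=> [/nullset_scale|]; first exact.
move/(nullset_scale s (topp (X z))); congr nullset; apply: eq_bigr => y _.
by rewrite /H !toppM smulN toppK sVKmul.
Qed.

End Ratios.

(** * Circuit vectors and orthogonality from coordinates *)

Section QuasiPlucker.
Variables (E : finType) (N : matroid E) (T : skewTract) (s : side).
Variable br : {set E} * {set E} -> T.
Hypothesis qp : quasi_plucker s N br.
Implicit Types (F J S I : {set E}) (X Y Z : {ffun E -> T}) (a b x y z : E).

Local Notation "x ** y" := (smul s x y) (at level 40, left associativity).

Lemma qp_invJ J a b : a \notin J -> b \notin J -> a != b ->
  a |: J \in bases N -> b |: J \in bases N ->
  br (a |: J, b |: J) ** br (b |: J, a |: J) = tone.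
Proof.
by move=> aJ bJ ab ba bb; apply: (qp_inv qp) => //; apply: basisU1_card ba.
Qed.

Lemma qp_invI I a b : a \in I -> b \in I -> a != b ->
  I :\ a \in bases N -> I :\ b \in bases N ->
  br (I :\ a, I :\ b) ** br (I :\ b, I :\ a) = tone.
Proof.
move=> aI bI ab; move: (setD1D1U1 aI bI ab); set F := _ :\ b => -[aF bF <- <- _].
by move=> ba bb; apply: qp_invJ; rewrite 1?eq_sym.
Qed.

Lemma qp_neq0I I a b : a \in I -> b \in I -> a != b ->
  I :\ a \in bases N -> I :\ b \in bases N -> br (I :\ a, I :\ b) != tzero.
Proof.
move=> aI bI ab ba bb; have := qp_invI aI bI ab ba bb.
by apply: contra_eqN => /eqP->; rewrite s0mul.
Qed.

Lemma qp_triangleI I a b c : a \in I -> b \in I -> c \in I ->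
  a != b -> b != c -> a != c ->
  I :\ a \in bases N -> I :\ b \in bases N -> I :\ c \in bases N ->
  br (I :\ b, I :\ a) ** br (I :\ c, I :\ b) ** br (I :\ a, I :\ c)
    = topp tone.
Proof.
move=> aI bI cI ab bc ac ba bb bc'; pose F := I :\ a :\ b :\ c.
have [aF bF cF] : [/\ a \notin F, b \notin F & c \notin F].
  by split; rewrite !inE ?eqxx ?andbF.
have sw x y z : [set x; y; z] = [set a; b; c] -> x != z -> y != z ->
    x \in I -> y \in I -> I :\ z = F :|: [set x; y].
  move=> e xz yz xI yI; apply/setP => w; have /setP/(_ w) := e; rewrite !inE.
  case: (eqVneq w x) => [->|_]; first by rewrite xz xI /= orbT.
  case: (eqVneq w y) => [->|_]; first by rewrite yz yI /= orbT.
  rewrite /= orbF; case: (eqVneq w z) => /= _.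
    by case: (w == a); case: (w == b); case: (w == c).
  by case: (w == a); case: (w == b); case: (w == c).
have ec : I :\ c = F :|: [set a; b] by apply: sw.
have eb : I :\ b = F :|: [set a; c].
  by apply: sw; rewrite 1?[c == b]eq_sym // -!setUA [[set c] :|: _]setUC.
have ea : I :\ a = F :|: [set b; c].
  apply: sw; rewrite 1?[_ == a]eq_sym // -?setUA //.
  by rewrite [[set c] :|: _]setUC [LHS]setUA [[set b] :|: _]setUC -setUA.
have cardF : #|F|.+2 = mrank N.
  rewrite -(basis_card ba) (cardsD1 b (I :\ a)) (cardsD1 c (I :\ a :\ b)).
  by rewrite !inE bI cI [b == a]eq_sym [c == a]eq_sym [c == b]eq_sym ab ac bc.
have u : uniq [:: a; b; c] by rewrite /= !inE negb_or ab ac bc.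
have := qp_triangle qp aF bF cF u cardF.
by rewrite /= -ec -eb -ea => /(_ bc' bb ba).
Qed.

(** If fewer than three elements of I lie outside J, counting forces I = Jab, and both sides are the
    same value of the bracket. Otherwise this is (P4)'. *)
Lemma qp_cross_trivial I J a b : a != b -> #|I| = (mrank N).+1 -> #|J|.+1 = mrank N ->
  exchangeable N I J = [set a; b] ->
  br (I :\ a, I :\ b) = br (b |: J, a |: J).
Proof.
move=> ab cI cJ eE; have [/(qp_cross qp cI cJ)|small] := leqP 3 #|I :\: J|.
  by apply.
have [aE bE] : a \in exchangeable N I J /\ b \in exchangeable N I J.
  by rewrite eE !inE !eqxx orbT.
move: aE bE; rewrite !inE => /and3P[aI ba baJ] /and3P[bI bb bbJ].
have aJ := basisU1_notin baJ cJ; have bJ := basisU1_notin bbJ cJ.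
suff -> : I = a |: (b |: J) by have [-> ->] := setU1U1D1 aJ bJ ab.
apply/esym/eqP; rewrite eqEcard !subUset !sub1set aI bI /=; apply/andP; split.
  have := cardsID J I; rewrite cI => cc.
  have cIJ : (#|J| <= #|I :&: J|)%N by lia.
  have /eqP <- : I :&: J == J by rewrite eqEcard subsetIr.
  exact: subsetIl.
by rewrite !cardsU1 !inE negb_or ab aJ bJ; lia.
Qed.

Lemma card_span I e : e \in I -> I :\ e \in bases N -> #|I| = (mrank N).+1.
Proof. by move=> eI /basis_card <-; rewrite (cardsD1 e I) eI. Qed.

(** With J equal to I minus a and b, an element exchangeable between I' and J lies on S, hence in I,
    but not in J; so it is a or b and the cross relation applies. *)
Lemma qp_bracket_span S I I' a b : S \in circuits N -> S \subset I -> S \subset I' ->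
  a != b -> a \in S -> b \in S ->
  (forall x, x \in S -> I :\ x \in bases N) ->
  (forall x, x \in S -> I' :\ x \in bases N) ->
  br (I :\ a, I :\ b) = br (I' :\ a, I' :\ b).
Proof.
move=> cS SI SI' ab aS bS bI bI'.
have [aI bI0] := (subsetP SI _ aS, subsetP SI _ bS).
move: (setD1D1U1 aI bI0 ab); set J := _ :\ b => -[aJ bJ eb ea eI].
clearbody J.
have baJ : a |: J \in bases N by rewrite eb bI.
have bbJ : b |: J \in bases N by rewrite ea bI.
have cJ := basisU1_card aJ baJ.
rewrite -ea -eb; apply/esym/qp_cross_trivial => //.
  by apply: card_span (bI' _ aS); rewrite (subsetP SI').
apply/setP => x; rewrite !inE; apply/and3P/orP.
  case=> xI' bx bxJ; have xS := circuit_basis_mem cS SI' bx.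
  have := subsetP SI _ xS; rewrite -eI !inE (negPf (basisU1_notin bxJ cJ)) orbF.
  by case/orP=> ->; [left|right].
by case=> /eqP->; split=> //; rewrite ?(subsetP SI') ?bI'.
Qed.

(** Fix a base point x0 with entry 1 and let the bracket inside one I dictate the other entries.
    Ratios involving x0 come from (P1), the others from (P2), and [qp_bracket_span] transfers them
    to any other I'. *)
Lemma circuits_of_exists S : S \in circuits N ->
  exists2 X, circuits_of s N br X & supp X = S.
Proof.
move=> cS; have /set0Pn[x0 x0S] := circuit_neq0 cS.
have [I SI bI] := circuit_span cS.
have mI x : x \in S -> x \in I by move/(subsetP SI).
pose X : {ffun E -> T} := [ffun y => if y == x0 then tone else
  if y \in S then topp (br (I :\ y, I :\ x0)) else tzero].
have XS : supp X = S.
  apply/setP => y; rewrite inE ffunE; case: (eqVneq y x0) => [->|yx0].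
    by rewrite x0S.
  case: (boolP (y \in S)) => [yS|_]; last by rewrite eqxx.
  by rewrite topp_eq0 qp_neq0I ?mI ?bI.
exists X => //; apply/circuits_ofP; rewrite XS; split=> // I' a b ab.
rewrite XS => aS bS SI' bIa bIb.
have bI' x : x \in S -> I' :\ x \in bases N.
  by apply: (circuit_basis_rem cS SI' _ bIa); rewrite (subsetP SI').
rewrite -(@qp_bracket_span S I I') 1?eq_sym // !ffunE aS bS.
have V x y : x \in S -> y \in S -> x != y ->
    br (I :\ x, I :\ y) ** br (I :\ y, I :\ x) = tone.
  by move=> xS yS xy; rewrite qp_invI ?mI ?bI.
have [ax|ax0] := eqVneq a x0.
  rewrite -ax eq_sym (negPf ab); have -> : tinv (@tone T) = tone.
    by rewrite /tone /= invg1.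
  by rewrite s1mul.
have tinvE : tinv (topp (br (I :\ a, I :\ x0))) = topp (br (I :\ x0, I :\ a)).
  by rewrite tinvN -(smul1_inv (V _ _ aS x0S ax0)).
have [->|bx0] := eqVneq b x0; first by rewrite smul1.
rewrite tinvE toppM smulN toppK.
have ba : b != a by rewrite eq_sym.
have := qp_triangleI (mI _ bS) (mI _ aS) (mI _ x0S) ba ax0 bx0
  (bI _ bS) (bI _ aS) (bI _ x0S).
by rewrite -smulA => e; rewrite -[LHS](s1mul s) -(V _ _ bS aS ba) -smulA e smulN smul1.
Qed.

(** A change of the normalizing point rescales the cocircuit; for three distinct points this is
    (P3). *)
Lemma cocircuitM J z z' y : z \notin J -> z |: J \in bases N ->
  z' \notin J -> z' |: J \in bases N ->
  cocircuit N br J z' y ** cocircuit N br J z z' = cocircuit N br J z y.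
Proof.
move=> zJ bz z'J bz'; rewrite /cocircuit bz'.
have [->|zz'] := eqVneq z' z; first by rewrite smul1.
have [->|yz'] := eqVneq y z'; first by rewrite s1mul (negPf zz') bz'.
have [->|yz] := eqVneq y z; first by rewrite bz qp_invJ // eq_sym.
case: ifP => by_; last by rewrite s0mul.
have yJ := basisU1_notin by_ (basisU1_card zJ bz).
have u : uniq [:: y; z'; z] by rewrite /= !inE negb_or yz' yz zz'.
have := qp_cocycle qp yJ z'J zJ u (basisU1_card zJ bz) by_ bz' bz.
move/(congr1 (fun t => t ** br (y |: J, z |: J))).
by rewrite -[in LHS]smulA qp_invJ 1?eq_sym // smul1 s1mul.
Qed.

(** If the cocircuit misses X, all terms vanish. Otherwise z may be moved onto X by [cocircuitM];
    the intersection then has at least two elements, and the pairing is governed by (P4)' for two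
    and by (P5)' for more. *)
Lemma circuits_of_orthogonal X : circuits_of s N br X -> cocircuit_orthogonal N s br X.
Proof.
move=> /circuits_ofP[cX rX] J z zJ bz.
have cJ := basisU1_card zJ bz.
wlog zX : z zJ bz / z \in supp X => [IH|].
  have [D0|/set0Pn[z']] := eqVneq (supp X :&: [set y | y |: J \in bases N]) set0.
    rewrite big1 => [|y _]; first exact: nullset0.
    rewrite /cocircuit; case: eqP => [->|_].
      move/setP/(_ z): D0; rewrite in_setI in_set bz andbT in_set0 => /negbT zX.
      by rewrite (supp0 zX) s0mul.
    case: ifP => by_; last by rewrite smul0.
    move/setP/(_ y): D0; rewrite in_setI in_set by_ andbT in_set0 => /negbT yX.
    by rewrite (supp0 yX) s0mul.
  rewrite in_setI in_set => /andP[z'X bz'].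
  have z'J := basisU1_notin bz' cJ.
  have := nullset_scaler s (cocircuit N br J z z') (IH z' z'J bz' z'X).
  by under eq_bigr do rewrite -smulA (cocircuitM _ zJ bz z'J bz').
have [I XI bI] := circuit_span cX.
have zI := subsetP XI _ zX.
have cI := card_span zI (bI _ zX).
apply/(orthogonal_sum cX rX XI bI zX bz).
have inX := in_exchangeable J _ cX XI bI.
have zE : z \in exchangeable N I J by rewrite inX zX bz.
have [y [yX yz yJ by_]] := circuit_cocircuit cX zX zJ bz.
have yE : y \in exchangeable N I J by rewrite inX yX by_.
have [c3|c2] := leqP 3 #|exchangeable N I J|.
  apply: (qp_exchange qp) => //; apply: leq_trans c3 _.
  apply/subset_leq_card/subsetP => x; rewrite !inE => /and3P[-> _ bx].
  by rewrite (basisU1_notin bx cJ).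
(* Only -1 and the product for y remain, and (P4)' turns that product into an instance of (P1). *)
have eE : exchangeable N I J = [set y; z].
  apply/esym/eqP; rewrite eqEcard subUset !sub1set yE zE cards2 yz.
  by move: c2.
rewrite (big_pred1 y) => [|x]; last first.
  rewrite in_setD1 eE in_set2; case: (eqVneq x z) => [->|_] /=.
    by rewrite eq_sym (negPf yz).
  by rewrite orbF.
apply/nullset_two; rewrite toppK (qp_cross_trivial yz cI cJ eE).
by rewrite qp_invJ // eq_sym.
Qed.

Lemma supports_circuits_of : supports (circuits_of s N br) = circuits N.
Proof.
apply/setP => S; rewrite inE; apply/asboolP/idP => [[X [cX _] <-]//|cS].
by have [X] := circuits_of_exists cS; exists X.
Qed.

(** All admissible vectors yield the same value, and the fundamental circuit of b with respect to Fa
    supplies one, so the default of [xget] is never returned. *)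
Lemma circuits_of_bracket : {in adjacent N, br =1 bracket_of s (circuits_of s N br)}.
Proof.
move=> p pA; rewrite /bracket_of; set P := (fun t : T => _).
have Pbr t : P t -> t = br p.
  case=> F [a] [b] [X] [[aF bF ep] [[_ rX] abX XF ->]].
  by rewrite (rX _ _ _ aF bF _ abX XF) ?toppK -?ep.
rewrite -(Pbr (xget tzero P)) //; apply: xgetPex.
have [F [a [b [aF bF ab ep]]]] := adjacentP pA.
move: pA; rewrite ep adjacent_setU1 // => /and3P[ba bb _].
have bF' : b \notin a |: F by rewrite !inE negb_or bF eq_sym ab.
have [S [cS bS SI]] := fundamental_circuit ba bF'.
have [X cX XS] := circuits_of_exists cS.
have [ea eb] := setU1U1D1 aF bF ab.
exists (topp (tinv (X a) ** X b)), F, a, b, X; split=> //; split=> //.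
  rewrite subUset !sub1set XS bS andbT.
  by apply: circuit_basis_mem cS SI _; rewrite setUCA ea.
by rewrite XS setUCA.
Qed.

End QuasiPlucker.

(** * Families of circuits with private elements *)

Section Family.
Variables (E : finType) (T : skewTract) (k : nat).
Implicit Types (X : {ffun E -> T}) (C : set {ffun E -> T}).

Lemma ears_family (S : 'I_k -> {set E}) (e : 'I_k -> E) (t : seq 'I_k)
    (u : seq {set E}) :
  uniq t -> (forall i, e i \in S i) -> (forall i j, j != i -> e i \notin S j) ->
  (forall i, e i \notin \bigcup_(B <- u) B) -> ears u ->
  ears ([seq S i | i <- t] ++ u).
Proof.
move=> ut eS eSn eu earu; elim: t ut => //= i t IH /andP[it ut].
rewrite IH // andbT; apply/subsetPn; exists (e i) => //.
rewrite big_cat big_map /= in_setU negb_or eu andbT bigcup_seq.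
apply/bigcupP => -[j jt]; apply/negP/eSn.
by apply: contraNneq it => <-.
Qed.

Lemma bigcup_family X (Xs : 'I_k -> {ffun E -> T}) :
  \bigcup_(B <- [seq supp Y | Y <- X :: [seq Xs i | i : 'I_k]]) B =
  supp X :|: \bigcup_i supp (Xs i).
Proof. by rewrite big_map big_cons big_map big_enum. Qed.

Lemma size_family X (Xs : 'I_k -> {ffun E -> T}) :
  size [seq supp Y | Y <- X :: [seq Xs i | i : 'I_k]] = k.+1.
Proof. by rewrite size_map /= size_map -cardE card_ord. Qed.

Lemma mem_family C X (Xs : 'I_k -> {ffun E -> T}) :
  (forall Y, Y \in X :: [seq Xs i | i : 'I_k] -> C Y) <->
  C X /\ forall i, C (Xs i).
Proof.
split=> [H|[CX CXs] Y]; last first.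
  by rewrite inE => /orP[/eqP->//|/imageP[i _ ->]].
split=> [|i]; apply: H; rewrite inE ?eqxx //.
by apply/orP; right; apply: image_f.
Qed.

End Family.

(** * Strong elimination from orthogonality *)

Section Elimination.
Variables (E : finType) (N : matroid E) (T : skewTract) (s : side).
Variable br : {set E} * {set E} -> T.
Hypothesis qp : quasi_plucker s N br.
Implicit Types (F J S I B : {set E}) (X Y Z : {ffun E -> T}).

Local Notation "x ** y" := (smul s x y) (at level 40, left associativity).
Local Notation C := (circuits_of s N br).

Lemma sum_support2 (U : nmodType) (F : E -> U) (a b : E) : a != b ->
  (forall y, y != a -> y != b -> F y = 0) -> \sum_y F y = F a + F b.
Proof.
move=> ab F0; rewrite (bigD1 a) // (bigD1 b) /=; last by rewrite eq_sym.
by rewrite big1 ?addr0 // => y /andP[ya yb]; apply: F0.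
Qed.

Lemma sum_support_family (U : nmodType) (F : E -> U) (a b : E) k (e : 'I_k -> E) :
  a != b -> injective e -> (forall i, e i != a) -> (forall i, e i != b) ->
  (forall y, y != a -> y != b -> (forall i, y != e i) -> F y = 0) ->
  \sum_y F y = F a + (F b + \sum_i F (e i)).
Proof.
move=> ab einj ea eb F0; rewrite (bigD1 a) // (bigD1 b) /=; last by rewrite eq_sym.
have <- : \sum_(y in [set e i | i : 'I_k]) F y = \sum_i F (e i).
  by rewrite big_imset /= => [|i j _ _ /einj]; first apply: eq_bigl.
congr (_ + (_ + _)); rewrite big_mkcond [RHS]big_mkcond; apply: eq_bigr => y _.
case: imsetP => [[i _ ->]|ye]; first by rewrite ea eb.
by case: ifP => // /andP[ya yb]; apply: F0 => // i; apply/eqP => yi; apply: ye; exists i.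
Qed.

Section Modular.
Variables (k : nat) (Xs : 'I_k -> {ffun E -> T}) (X : {ffun E -> T}).
Variables (e : 'I_k -> E) (g : E).
Hypothesis fam : modular_family C (X :: [seq Xs i | i : 'I_k]).
Hypothesis gX : g \in supp X.
Hypothesis gXs : forall i, g \notin supp (Xs i).
Hypothesis eXs : forall i, e i \in supp (Xs i).
Hypothesis eXsn : forall i j, j != i -> e i \notin supp (Xs j).

Let A := supp X :|: \bigcup_i supp (Xs i).
Let B0 := A :\: (g |: [set e i | i : 'I_k]).

Lemma family_circuit : supp X \in circuits N /\ forall i, supp (Xs i) \in circuits N.
Proof. by have [/mem_family[[cX _] cXs] _] := fam; split=> // i; case: (cXs i). Qed.

Lemma pivot_neq i : e i != g.
Proof. by apply: contraNneq (gXs i) => <-. Qed.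

Lemma pivot_inj : injective e.
Proof.
move=> i j eij; apply/eqP; rewrite eq_sym; apply: contraT => ij.
by have := eXsn ij; rewrite eij eXs.
Qed.

(* A circuit inside [B0] could be put in front of the family, which would     *)
(* give a chain of unions that is too long.                                   *)
Lemma modular_rest_indep : independent N B0.
Proof.
apply: contraT => /dep_circuit[S cS SB0]; have [cX cXs] := family_circuit.
have [_ [_]] := fam; rewrite (supports_circuits_of qp) bigcup_family size_family.
have Sn x : x \in S -> x \in A /\ x \notin g |: [set e i | i : 'I_k].
  by move/(subsetP SB0); rewrite inE => /andP[].
have eS i : e i \notin S.
  apply/negP => /Sn[_ /negP]; apply; rewrite !inE; apply/orP; right.
  by apply/imsetP; exists i.
(* These are k + 2 ears inside A, whereas modularity gives height k + 1. The circuit S comes last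
   because it avoids g and all the pivots, which therefore remain new. *)
pose fs := supp X :: [seq supp (Xs i) | i <- enum 'I_k] ++ [:: S].
have fsE : \bigcup_(B <- fs) B = supp X :|: (\bigcup_i supp (Xs i) :|: S).
  by rewrite big_cons big_cat big_map big_enum big_seq1.
have : (size fs <= height (circuits N) A)%N.
  apply: ears_height.
  - move=> B; rewrite inE mem_cat inE => /or3P[/eqP->//| |/eqP->//].
    by case/mapP=> i _ ->.
  - rewrite /= (ears_family (e := e)) ?enum_uniq ?andbT //=.
    + apply/subsetPn; exists g => //; rewrite big_cat big_map big_enum big_seq1.
      rewrite inE negb_or; apply/andP; split.
        by apply/bigcupP => -[i _]; apply/negP/gXs.
      by apply/negP => /Sn[_]; rewrite setU11.
    + by move=> i; rewrite big_seq1.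
    by rewrite big_nil andbT subset0 (circuit_neq0 cS).
  rewrite fsE setUA subUset subxx /=.
  by apply/subsetP => x /Sn[].
by rewrite /fs /= size_cat size_map -cardE card_ord addn1 => lt1 eq1;
  rewrite eq1 ltnn in lt1.
Qed.

(** Otherwise some cocircuit through g meets A only in g and pivots. A circuit never meets a
    cocircuit in one point, so X carries a second one, a pivot e_i; but then X_i meets the cocircuit
    in e_i alone. *)
Lemma modular_rest_dep : ~~ independent N (g |: B0).
Proof.
apply/negP => /existsP[B /andP[bB gB]]; have [cX cXs] := family_circuit.
pose J := B :\ g; have gBin : g \in B by apply: (subsetP gB); rewrite setU11.
have gJ : g \notin J by rewrite setD11.
have bgJ : g |: J \in bases N by rewrite setD1K.
have restJ y : y \in A -> y \notin J -> y = g \/ exists i, y = e i.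
  move=> yA yJ; have [->|yg] := eqVneq y g; first by left.
  right; apply/exists_eqP; apply: contraNT yJ => /existsPn yn.
  rewrite in_setD1 yg (subsetP gB) // in_setU1; apply/orP; right.
  rewrite in_setD yA andbT in_setU1 (negPf yg) /=; apply/negP => /imsetP[i _ yi].
  by have := yn i; rewrite yi eqxx.
have [y [yX yg yJ bY]] := circuit_cocircuit cX gX gJ bgJ.
have [|yg'|[i yi]] := restJ y _ yJ; first by rewrite inE yX.
  by rewrite yg' eqxx in yg.
rewrite yi in yJ bY.
have [y' [yXi ye y'J _]] := circuit_cocircuit (cXs i) (eXs i) yJ bY.
have [|y'g|[j y'j]] := restJ y' _ y'J.
- by rewrite inE; apply/orP; right; apply/bigcupP; exists i.
- by have := gXs i; rewrite -y'g yXi.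
have := eXsn (i := j) (j := i); rewrite -y'j yXi => /(_ _)/negP; apply=> //.
by apply: contraNneq ye => ->; rewrite y'j.
Qed.

Hypothesis eE : forall i, X (e i) = topp (Xs i (e i)).

Lemma modular_elim : exists Z, [/\ C Z, (forall i, Z (e i) = tzero) &
  forall f, nullset (tinj (X f) + \sum_i tinj (Xs i f) + tinj (topp (Z f)))].
Proof.
have [/mem_family[CX CXs] _] := fam; have [cX cXs] := family_circuit.
have [S cS SgB] := dep_circuit modular_rest_dep.
have gS : g \in S.
  apply: contraNT (circuit_dep cS) => gS; apply: independentS modular_rest_indep.
  apply/subsetP => x xS; have := subsetP SgB _ xS; rewrite in_setU1.
  by case/orP=> // /eqP xg; rewrite -xg xS in gS.
have [Z1 CZ1 Z1S] := circuits_of_exists qp cS.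
have Z1g : Z1 g != tzero by rewrite -suppE Z1S.
have Xg : X g != tzero by rewrite -suppE.
have c0 : X g ** tinv (Z1 g) != tzero.
  by rewrite smul_eq0 tinv_eq0 negb_or Xg Z1g.
(* Only X and Z are nonzero at g among the vectors involved, so Z has to agree with X there. *)
pose Z := vscale s (X g ** tinv (Z1 g)) Z1.
have ZS : supp Z = S by rewrite supp_vscale.
have Zg : Z g = X g by rewrite ffunE smulVK.
have CZ : C Z.
  by have [_ r] := (circuits_ofP N s br Z1).1 CZ1; apply/circuits_ofP;
    rewrite ZS; split=> //; apply: ratios_scale.
have Zsub y : y \notin g |: B0 -> Z y = tzero.
  by move=> yB; apply: supp0; rewrite ZS; apply: contraNN yB => /(subsetP SgB).
have eg := pivot_neq.
have eB0 i : e i \notin B0.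
  rewrite in_setD negb_and negbK in_setU1; apply/orP; left.
  by apply/orP; right; apply/imsetP; exists i.
have gB0 : g \notin B0 by rewrite in_setD setU11.
have Ze i : Z (e i) = tzero by apply: Zsub; rewrite in_setU1 negb_or eg eB0.
exists Z; split=> // f.
have [fB0|fB0] := boolP (f \in B0); last first.
  have [->|fg] := eqVneq f g.
    rewrite big1 ?addr0 => [|i _]; last by rewrite supp0.
    by apply/nullset_two; rewrite Zg.
  have Zf : Z f = tzero by apply: Zsub; rewrite in_setU1 negb_or fg.
  rewrite Zf topp0 [tinj tzero]/= addr0.
  have [fA|fA] := boolP (f \in A); last first.
    move: fA; rewrite in_setU negb_or => /andP[/supp0-> /bigcupP fXs].
    rewrite big1 ?addr0 => [|i _]; first exact: nullset0.
    by rewrite supp0 //; apply/negP => fi; apply: fXs; exists i.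
  move: fB0; rewrite in_setD fA andbT negbK in_setU1 (negPf fg) /=.
  case/imsetP=> i _ ->; rewrite (bigD1 i) //= big1 ?addr0 => [|j ji].
    by apply/nullset_two; rewrite eE toppK.
  by rewrite supp0 // eXsn.
have [B [bB B0B]] : exists B, B \in bases N /\ B0 \subset B.
  by have /existsP[B /andP[]] := modular_rest_indep; exists B.
(* The cocircuit of this J, normalized at f, meets A only in f, g and the pivots, so its pairings
   with X_i and Z have two terms each. *)
pose J := B :\ f; have fB := subsetP B0B _ fB0.
have fJ : f \notin J by rewrite setD11.
have bfJ : f |: J \in bases N by rewrite setD1K.
pose c y := cocircuit N br J f y.
have cf : c f = tone by rewrite /c cocircuit_z.
have fg : f != g by apply: contraNneq gB0 => <-.
have ef i : e i != f by apply: contraNneq (eB0 i) => ->.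
have c_out y : y \in A -> y != f -> y != g -> (forall i, y != e i) -> c y = tzero.
  move=> yA yf yg ye; apply: cocircuit_in => //; rewrite in_setD1 yf (subsetP B0B) //.
  rewrite in_setD yA andbT in_setU1 (negPf yg) /=.
  by apply/imsetP => -[i _ yi]; have := ye i; rewrite yi eqxx.
have orth Y : C Y -> nullset (\sum_y tinj (Y y ** c y)).
  by move=> CY; apply: circuits_of_orthogonal.
have out_supp Y y : y \notin supp Y -> tinj (Y y ** c y) = 0.
  by move/supp0->; rewrite s0mul.
have XsA i y : y \in supp (Xs i) -> y \in A.
  by move=> yi; rewrite inE; apply/orP; right; apply/bigcupP; exists i.
have Xsf i : Xs i f = X (e i) ** c (e i).
  have := orth _ (CXs i); rewrite (@sum_support2 _ _ f (e i)) 1?eq_sym //.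
    by rewrite cf smul1 => /nullset_two; rewrite eE toppM => ->; rewrite toppK.
  move=> y yf ye; have [yi|/out_supp//] := boolP (y \in supp (Xs i)).
  rewrite c_out ?smul0 //; first exact: XsA yi.
    by apply: contraTneq yi => ->.
  move=> j; have [->//|ji] := eqVneq j i.
  by apply: contraTneq yi => ->; apply: eXsn; rewrite eq_sym.
have Zf : X g ** c g = topp (Z f).
  have := orth _ CZ; rewrite (@sum_support2 _ _ f g) //.
    by rewrite cf smul1 Zg => /nullset_two.
  move=> y yf yg; have [yZ|/out_supp//] := boolP (y \in supp Z).
  move: yZ; rewrite ZS => /(subsetP SgB); rewrite in_setU1 (negPf yg) /= => yB0.
  rewrite c_out ?smul0 //; first by move: yB0; rewrite in_setD => /andP[].
  by move=> i; apply: contraTneq yB0 => ->.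
(* In the pairing with X, the term at e_i equals X_i(f) and the term at g equals -Z(f), which gives
   the required sum at f. *)
have := orth _ CX; rewrite (@sum_support_family _ _ f g k e) //; last first.
- move=> y yf yg ye; have [yX|/out_supp//] := boolP (y \in supp X).
  by rewrite c_out ?smul0 // inE yX.
- exact: pivot_inj.
under [in X in _ + (_ + X)]eq_bigr do rewrite -Xsf.
by rewrite cf smul1 Zf [X in _ + X]addrC addrA.
Qed.

End Modular.

Lemma circuits_of_strong : strong_matroid s C.
Proof.
split.
- case=> /circuit_dep/negP[]; have /set0Pn[B bB] := bases_neq0 N.
  apply: independentS (basis_independent bB); apply/subsetP => x.
  by rewrite inE ffunE eqxx.
- move=> X a /circuits_ofP[cX rX]; apply/circuits_ofP.
  by rewrite supp_vscale //; split=> //; apply: ratios_scale.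
- move=> X Y /circuits_ofP[cX rX] /circuits_ofP[cY rY] XY.
  have eXY := circuit_incomp cX cY XY.
  have /set0Pn[a aX] := circuit_neq0 cX.
  have [|c cE] := @neq0_tgen T (Y a ** tinv (X a)).
    by rewrite smul_eq0 tinv_eq0 negb_or -!suppE -eXY aX.
  by exists c; rewrite -cE; apply: ratios_eq rX rY aX.
move=> k Xs X e fam /subsetPn[g gX /bigcupP gXs] eP eE.
apply: (@modular_elim k Xs X e g) => //.
- by move=> i; apply/negP => gi; apply: gXs; exists i.
- by move=> i; have := eP i; rewrite in_setD in_setI => /and3P[_ _ eiX].
- move=> i j ji; have := eP i; rewrite in_setD => /andP[/bigcupP ei _].
  by apply/negP => ej; apply: ei; exists j.
by move=> i; have [] := eE i.
Qed.

End Elimination.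

(** * Coordinates from a strong T-matroid *)

Section Strong.
Variables (E : finType) (N : matroid E) (T : skewTract) (s : side).
Variables (br : {set E} * {set E} -> T) (C : set {ffun E -> T}).
Hypothesis strongC : strong_matroid s C.
Hypothesis suppC : supports C = circuits N.
Hypothesis brC : {in adjacent N, br =1 bracket_of s C}.
Implicit Types (F J S I B : {set E}) (X Y Z : {ffun E -> T}).

Local Notation "x ** y" := (smul s x y) (at level 40, left associativity).

Lemma strong_circuit X : C X -> supp X \in circuits N.
Proof. by move=> CX; rewrite -suppC inE; apply/asboolP; exists X. Qed.

Lemma strong_exists S : S \in circuits N -> exists2 X, C X & supp X = S.
Proof. by rewrite -suppC inE => /asboolP. Qed.

Lemma strong_ratio X Y a b : C X -> C Y -> supp X = supp Y ->
  tinv (X a) ** X b = tinv (Y a) ** Y b.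
Proof.
move=> CX CY XY; have [|c ->] := circ_incomp strongC CX CY; first by rewrite XY.
rewrite !ffunE tinvM -smulA sKmul //.
Qed.

Lemma strong_ratios X : C X -> ratios N s br X.
Proof.
move=> CX I a b ab aX bX XI bIa bIb; have cX := strong_circuit CX.
have [aI bI] := (subsetP XI _ aX, subsetP XI _ bX).
move: (setD1D1U1 aI bI ab); set F := _ :\ b => -[aF bF eb ea eI].
clearbody F.
rewrite brC -?ea -?eb; last by rewrite adjacent_setU1 // ea eb bIa bIb.
rewrite /bracket_of; set P := (fun t : T => _).
suff Pt t : P t -> t = topp (tinv (X a) ** X b).
  have /(xgetPex tzero)/Pt -> : exists t, P t; last by rewrite toppK.
  exists (topp (tinv (X a) ** X b)), F, a, b, X; split=> //; split=> //.
    by rewrite subUset !sub1set aX bX.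
  by rewrite eI.
case=> F' [a'] [b'] [Y] [[aF' bF' ep] [CY abY YF ->]].
have [eF eaa ebb] := setU1_pair_inj aF bF aF' bF' ab ep.
rewrite -eaa -ebb; congr topp; apply: strong_ratio => //.
apply: (circuit_unique (strong_circuit CY) (I := I) (e := a)) => //.
by rewrite -eI eF eaa ebb.
Qed.

(* X expands along the fundamental circuits of the basis B: strong            *)
(* elimination applied to all of them but the one through g leaves the        *)
(* opposite of the latter.                                                    *)
Lemma basis_expansion B X (Xf : E -> {ffun E -> T}) : B \in bases N -> C X ->
  (forall y, y \in supp X :\: B ->
    [/\ C (Xf y), supp (Xf y) \subset y |: B & Xf y y = topp (X y)]) ->
  forall f, nullset (tinj (X f) + \sum_(y in supp X :\: B) tinj (Xf y f)).
Proof.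
move=> bB CX XfP f; have cX := strong_circuit CX.
have /subsetPn[g gX gB] := circuit_nbasis cX bB.
have gP : g \in supp X :\: B by rewrite inE gX gB.
pose P := supp X :\: B :\ g.
pose e (i : 'I_#|P|) : E := enum_val i; pose Xs i := Xf (e i).
have eP i : e i \in P by apply: enum_valP.
have PE y : y \in P -> [/\ y != g, y \in supp X & y \notin B].
  by rewrite in_setD1 in_setD => /and3P[].
have PXf y : y \in P ->
    [/\ C (Xf y), supp (Xf y) \subset y |: B & Xf y y = topp (X y)].
  by move=> yP; apply: XfP; move: yP; rewrite in_setD1 => /andP[].
have eXs i : e i \in supp (Xs i).
  have [_ eX _] := PE _ (eP i); have [_ _ XfE] := PXf _ (eP i).
  by rewrite suppE XfE topp_eq0 -suppE.
have XsB i y : y \in supp (Xs i) -> y \notin B -> y = e i.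
  have [_ sub _] := PXf _ (eP i).
  by move/(subsetP sub); rewrite in_setU1 => /orP[/eqP//|->].
have einj : injective e by apply: enum_val_inj.
have eXsn i j : j != i -> e i \notin supp (Xs j).
  move=> ji; apply/negP => /XsB; have [_ _ eB] := PE _ (eP i).
  by move=> /(_ eB)/einj ij; rewrite ij eqxx in ji.
have gXs i : g \notin supp (Xs i).
  apply/negP => /XsB/(_ gB) ge; have [] := PE _ (eP i).
  by rewrite -ge eqxx.
have CXs i : C (Xs i) by have [] := PXf _ (eP i).
(* The union lies in the union of B and supp X, which has |P| + 1 elements more than a basis; g and
   the pivots provide |P| + 1 ears. *)
have fam : modular_family C (X :: [seq Xs i | i : 'I_#|P|]).
  split; first exact/mem_family.
  rewrite suppC; split=> [S /mapP[Y YF ->]|].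
    apply: strong_circuit; move: Y YF; exact/mem_family.
  apply/eqP; rewrite eqn_leq; apply/andP; split.
    rewrite size_family bigcup_family; have := @height_nullity _ N
      (supp X :|: \bigcup_i supp (Xs i)) (supp X :|: B) B bB (subsetUr _ _).
    have -> : #|supp X :|: B| = (#|P|.+1 + mrank N)%N.
      rewrite -(basis_card bB) -(cardsID B (supp X :|: B)).
      rewrite (setIidPr (subsetUr (supp X) B)).
      by rewrite setDUl setDv setU0 (cardsD1 g (_ :\: _)) gP addnC.
    move=> H; rewrite -(leq_add2r (mrank N)); apply: H.
    rewrite subUset subsetUl /=; apply/bigcupsP => i _; apply/subsetP => y yi.
    rewrite in_setU orbC; have [//|yB] := boolP (y \in B).
    by rewrite (XsB i y yi yB) /=; have [] := PE _ (eP i).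
  apply: ears_height; last by [].
    move=> S /mapP[Y YF ->].
    apply: strong_circuit; move: Y YF; exact/mem_family.
  rewrite /= -map_comp; apply/andP; split.
    apply/subsetPn; exists g => //; rewrite big_map big_enum.
    by apply/bigcupP => -[i _]; apply/negP/gXs.
  have := @ears_family E _ (fun i => supp (Xs i)) e (enum 'I_#|P|) [::].
  by rewrite cats0; apply=> // [|i]; rewrite ?enum_uniq // big_nil inE.
have [|i|i|Z [CZ Ze ZN]] := circ_elim strongC (e := e) fam.
- apply/subsetPn; exists g => //.
  by apply/bigcupP => -[i _]; apply/negP/gXs.
- have [_ eX _] := PE _ (eP i); rewrite in_setD in_setI eX eXs !andbT.
  by apply/bigcupP => -[j ji]; apply/negP/eXsn.
- have [_ eX _] := PE _ (eP i); have [_ _ XfE] := PXf _ (eP i).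
  by rewrite XfE toppK -suppE.
have Xs0 i y : y \notin supp (Xs i) -> tinj (Xs i y) = 0 by move/supp0 ->.
have Zg : Z g = X g.
  have := ZN g; rewrite big1 ?addr0 => [|i _]; last exact: Xs0.
  by move/nullset_two/topp_inj.
(* Outside B and g, Z vanishes at the pivots by construction; elsewhere X and all X_i vanish,
   leaving a null sum with the single term -Z(y). *)
have ZB : supp Z \subset g |: B.
  apply/subsetP => y; rewrite in_setU1 suppE; apply: contraNT.
  rewrite negb_or => /andP[yg yB]; have [yP|yP] := boolP (y \in P).
    by have := Ze (enum_rank_in yP y); rewrite /e enum_rankK_in // => ->.
  have yX : y \notin supp X.
    by apply: contraNN yP => yX; rewrite in_setD1 yg in_setD yB.
  have := ZN y; rewrite (supp0 yX) add0r big1 ?add0r => [|i _].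
    by move/nullset_one/eqP; rewrite topp_eq0.
  apply: Xs0; apply: contraNN yP => yi.
  by rewrite (XsB i y yi yB).
have [Cg gsub Xfg] := XfP _ gP.
(* Z and [Xf g] lie on the only circuit in B with g added and have opposite entries at g, so they
   are opposite everywhere. *)
have eZ : supp Z = supp (Xf g).
  apply: (circuit_unique (strong_circuit CZ) ZB (strong_circuit Cg) gsub (e := g)).
    by rewrite setU11.
  by rewrite setU1K.
have XfZ : Xf g f = topp (Z f).
  have Zg0 : Z g != tzero by rewrite Zg -suppE.
  have Xg0 : Xf g g != tzero by rewrite Xfg topp_eq0 -suppE.
  rewrite -[LHS](sVKmul s _ Xg0) (strong_ratio g f Cg CZ) ?eZ //.
  by rewrite Xfg -Zg toppM sVKmul.
rewrite (bigD1 g) //= XfZ [_ + \sum_(_ | _) _]addrC addrA.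
have := ZN f; congr (nullset (_ + _ + _)).
rewrite -(big_enum_val (fun y => tinj (Xf y f))) /=.
by apply: eq_bigl => y; rewrite in_setD1 andbC.
Qed.

(** Expand X over the basis Jz. The vector on the fundamental circuit of y has entry -X(y) at y,
    hence X(y)[Jy, Jz] at z when Jy is a basis and zero otherwise; the expansion at z is the
    pairing. *)
Lemma strong_orthogonal X : C X -> cocircuit_orthogonal N s br X.
Proof.
move=> CX J z zJ bz.
pose Xf y := xget [ffun=> tzero] (fun Y : {ffun E -> T} =>
  [/\ C Y, supp Y \subset y |: (z |: J) & Y y = topp (X y)]).
have XfP y : y \in supp X :\: (z |: J) ->
    [/\ C (Xf y), supp (Xf y) \subset y |: (z |: J) & Xf y y = topp (X y)].
  rewrite in_setD => /andP[yB yX].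
  apply: (@xgetPex _ _ (fun Y : {ffun E -> T} =>
    [/\ C Y, supp Y \subset y |: (z |: J) & Y y = topp (X y)])).
  have [S [cS yS SB]] := fundamental_circuit bz yB.
  have [Y CY YS] := strong_exists cS.
  have Yy : Y y != tzero by rewrite -suppE YS.
  have [|c cE] := @neq0_tgen T (topp (X y) ** tinv (Y y)).
    by rewrite smul_eq0 topp_eq0 tinv_eq0 negb_or -suppE yX.
  exists (vscale s (tgen c) Y); rewrite supp_vscale // YS ffunE -cE smulVK //.
  by split=> //; rewrite cE; apply: (circ_scale strongC).
have := basis_expansion bz CX XfP z; congr nullset.
rewrite [RHS](bigD1 z) //= cocircuit_z smul1; congr (_ + _).
rewrite big_mkcond [RHS]big_mkcond; apply: eq_bigr => y _.
rewrite in_setD in_setU1 negb_or; case: (eqVneq y z) => //= yz.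
have [yJ|yJ] /= := boolP (y \in J); first by rewrite cocircuit_in // smul0.
case: ifP => [yX|/negbT/supp0->]; last by rewrite s0mul.
have yB : y \notin z |: J by rewrite in_setU1 negb_or yz.
have [|Cy ysub Xfy] := XfP y; first by rewrite in_setD yB.
have [ey ez] := setU1U1D1 yJ zJ yz.
have yXf : y \in supp (Xf y) by rewrite suppE Xfy topp_eq0 -suppE.
congr tinj; rewrite /cocircuit (negPf yz); case: ifP => by_; last first.
  rewrite smul0; apply: supp0; apply: contraFN by_ => zXf; rewrite -ez.
  apply: (circuit_basis_rem (strong_circuit Cy) ysub (e := y)) => //.
    by rewrite setU11.
  by rewrite ey.
have zXf : z \in supp (Xf y).
  by apply: (circuit_basis_mem (strong_circuit Cy) ysub); rewrite ez.
have := strong_ratios Cy yz yXf zXf ysub; rewrite ey ez => /(_ bz by_).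
move/(congr1 (@topp T)); rewrite toppK => <-.
by rewrite Xfy tinvN toppM toppK sVKmul // -suppE.
Qed.

Lemma strong_circuits_of : C = circuits_of s N br.
Proof.
apply/seteqP; split=> X.
  by move=> CX; apply/circuits_ofP; split; [apply: strong_circuit | apply: strong_ratios].
case/circuits_ofP=> cX rX; have [Y CY YX] := strong_exists cX.
have /set0Pn[a aX] := circuit_neq0 cX.
have rY := strong_ratios CY.
have cY := strong_circuit CY.
have aY : a \in supp Y by rewrite YX.
rewrite (ratios_eq cY (esym YX) rY rX aY).
have [|c ->] := @neq0_tgen T (X a ** tinv (Y a)).
  by rewrite smul_eq0 tinv_eq0 negb_or -!suppE aX.
exact: circ_scale strongC _ _ CY.
Qed.

Lemma strong_span_circuit I z : z \in I -> I :\ z \in bases N -> exists X,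
  [/\ C X, z \in supp X, supp X \subset I &
      forall x, x \in supp X -> I :\ x \in bases N].
Proof.
move=> zI bI; have zIz : z \notin I :\ z by rewrite setD11.
have [S [cS zS SI]] := fundamental_circuit bI zIz; rewrite setD1K // in SI.
have [X CX XS] := strong_exists cS; exists X; rewrite XS; split=> // x.
exact: circuit_basis_rem bI.
Qed.

Lemma strong_invJ J a b : a \notin J -> b \notin J -> a != b ->
  a |: J \in bases N -> b |: J \in bases N ->
  br (a |: J, b |: J) ** br (b |: J, a |: J) = tone.
Proof.
move=> aJ bJ ab ba bb; have [ea eb] := setU1U1D1 aJ bJ ab.
have [|//|X [CX aX XI bI]] := @strong_span_circuit (a |: (b |: J)) a.
- by rewrite setU11.
- by rewrite ea.
have bX : b \in supp X.
  by apply: (circuit_basis_mem (strong_circuit CX) XI); rewrite eb.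
have r1 := strong_ratios CX ab aX bX XI; rewrite ea eb in r1.
have r2 := strong_ratios CX _ bX aX XI; rewrite ea eb eq_sym in r2.
rewrite -[br (a |: J, _)]toppK -[br (b |: J, _)]toppK -r1 // -r2 //.
by rewrite toppM smulN toppK smulA smulK ?sVmul // -suppE.
Qed.

(** (P1) and (P2) are identities between ratios of one vector; the remaining axioms are instances of
    orthogonality. *)
Lemma strong_quasi_plucker : quasi_plucker s N br.
Proof.
split.
- by move=> F a b aF bF ab _; apply: strong_invJ.
- move=> F a b c aF bF cF u cardF Fab Fac Fbc bab bac bbc.
  have [ab ac bc] : [/\ a != b, a != c & b != c].
    by move: u; rewrite /= !inE negb_or andbT => /andP[/andP[]].
  pose I := F :|: [set a; b; c].
  have eF x y z : [set x; y; z] = [set a; b; c] -> x != z -> y != z ->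
      z \notin F -> I :\ z = F :|: [set x; y].
    move=> e xz yz zF; rewrite /I -e; apply/setP => w; rewrite !inE.
    case: (eqVneq w z) => [->|_] /=; last by rewrite orbF.
    by rewrite (negPf zF) eq_sym (negPf xz) eq_sym (negPf yz).
  have ec : I :\ c = Fab by apply: eF.
  have eb : I :\ b = Fac.
    by apply: eF; rewrite 1?[c == b]eq_sym // -!setUA [[set c] :|: _]setUC.
  have ea : I :\ a = Fbc.
    apply: eF; rewrite 1?[_ == a]eq_sym // -?setUA //.
    by rewrite [[set c] :|: _]setUC [LHS]setUA [[set b] :|: _]setUC -setUA.
  have [|//|X [CX aX XI bI]] := @strong_span_circuit I a.
  + by rewrite !inE eqxx orbT.
  + by rewrite ea.
  have bX : b \in supp X.
    by apply: (circuit_basis_mem (strong_circuit CX) XI); rewrite eb.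
  have cX : c \in supp X.
    by apply: (circuit_basis_mem (strong_circuit CX) XI); rewrite ec.
  have r x y : x != y -> x \in supp X -> y \in supp X ->
      br (I :\ y, I :\ x) = topp (tinv (X x) ** X y).
    by move=> xy xX yX; rewrite (strong_ratios CX xy xX yX XI) ?toppK ?bI.
  rewrite -ea -eb -ec !r // 1?eq_sym //.
  rewrite !(toppM, smulN) toppK !smulA smulK -?suppE // smulK -?suppE //.
  by rewrite sVmul -?suppE.
- move=> F a b c aF bF cF u cardF ba bb bc'.
  have [ab ac bc] : [/\ a != b, a != c & b != c].
    by move: u; rewrite /= !inE negb_or andbT => /andP[/andP[]].
  have [ea eb] := setU1U1D1 aF bF ab.
  have [|//|X [CX aX XI bI]] := @strong_span_circuit (a |: (b |: F)) a.
  + by rewrite setU11.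
  + by rewrite ea.
  have bX : b \in supp X.
    by apply: (circuit_basis_mem (strong_circuit CX) XI); rewrite eb.
  (* X is supported in Fab, so its pairing with the cocircuit of F normalized at c has only the
     terms at a and b. *)
  have := strong_orthogonal CX cF bc'; rewrite (@sum_support2 _ _ _ a b) //.
    rewrite /cocircuit ba bb (negPf ac) (negPf bc) => /nullset_two.
    have := strong_ratios CX ab aX bX XI; rewrite ea eb => /(_ bb ba).
    move/(congr1 (@topp T)); rewrite toppK => <-.
    move=> e; rewrite toppM -smulA e smulN toppK sKmul -?suppE //.
    by rewrite strong_invJ.
  move=> y ya yb; have [yX|/supp0->] := boolP (y \in supp X); last by rewrite s0mul.
  have := subsetP XI _ yX; rewrite !in_setU1 (negPf ya) (negPf yb) /= => yF.
  by rewrite cocircuit_in // smul0.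
- move=> I J cI cJ _ a b ab eE.
  have [aE bE] : a \in exchangeable N I J /\ b \in exchangeable N I J.
    by rewrite eE !inE !eqxx orbT.
  move: aE bE; rewrite !inE => /and3P[aI ba baJ] /and3P[bI bb bbJ].
  have aJ := basisU1_notin baJ cJ; have bJ := basisU1_notin bbJ cJ.
  have [X [CX bX XI bIX]] := strong_span_circuit bI bb.
  have cX := strong_circuit CX; have rX := strong_ratios CX.
  have := (orthogonal_sum cX rX XI bIX bX bbJ).1 (strong_orthogonal CX bJ bbJ).
  rewrite (big_pred1 a) => [|x]; last first.
    rewrite in_setD1 eE in_set2; case: (eqVneq x b) => [->|_] /=.
      by rewrite eq_sym (negPf ab).
    by rewrite orbF.
  (* The product of the two brackets is 1, so (P1) identifies the first with the reversed second. *)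
  move/nullset_two; rewrite toppK => e.
  apply: (can_inj (@tinvK T)).
  by rewrite -(smul1_inv e) -(smul1_inv (strong_invJ bJ aJ _ bbJ baJ)) 1?eq_sym.
move=> I J cI cJ _ _ z zE; move: (zE); rewrite inE => /and3P[zI bz bzJ].
have zJ := basisU1_notin bzJ cJ.
have [X [CX zX XI bX]] := strong_span_circuit zI bz.
apply/(orthogonal_sum (strong_circuit CX) (strong_ratios CX) XI bX zX bzJ).
exact: strong_orthogonal.
Qed.

End Strong.

Theorem theorem3p14 (E : finType) (hE : (0 < #|E|)%N) (N : matroid E)
    (T : skewTract) (br : {set E} * {set E} -> T) (C : set {ffun E -> T})
    (s : side) :
  [/\ strong_matroid s C, supports C = circuits N &
      {in adjacent N, br =1 bracket_of s C}]
  <->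
  (quasi_plucker s N br /\ C = circuits_of s N br).
Proof.
split=> [[strongC suppC brC]|[qp ->]].
  by split; [apply: strong_quasi_plucker brC | apply: strong_circuits_of brC].
split; [exact: circuits_of_strong | exact: supports_circuits_of | ].
exact: circuits_of_bracket.
Qed.
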